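(* For each $n$ let $\bar\gamma_n$ be a lazy walk on $\{0,\dots,n\}$ with $\bar\gamma_n(0)=0$ minimizing $A(B,F;\gamma)$ among all lazy walks of length $n$ started at $0$ (free endpoint), and set \[ \ell_n=\operatorname{argmin}_{x\in\operatorname{range}(\bar\gamma_n)}d(x),\quad d_n=d(\ell_n),\quad \tau_n=\min\{i:\bar\gamma_n(i)\in\{\ell_n,\ell_n+1\}\}. \] Then with probability tending to $1$ as $n\to\infty$, $\bar\gamma_n(i)\in\{\ell_n,\ell_n+1\}$ for all $i\ge\tau_n$. Moreover, for every $\varepsilon>0$ there are $0<k_1<k_2$ such that for all sufficiently large $n$, \[ \mathbb P(k_1n^{\zeta}\le|\ell_n|\le k_2n^{\zeta})\ge1-\varepsilon,\quad \mathbb P(k_1n^{\zeta-1}\le d_n\le k_2n^{\zeta-1})\ge1-\varepsilon, \] \[ \mathbb P\big(k_1n^{\zeta}\le cn+A(B,F;\bar\gamma_n)\le k_2n^{\zeta}\big)\ge1-\varepsilon. \]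
   Context: Let $c>0$, $q>0$, $\kappa>-1$. $F=(F(x))_{x\in\mathbb Z}$ and $B=(B(i))_{i\in\mathbb Z}$ are mutually independent families of i.i.d. random variables, $\mathbb P(B(i)=\pm1)=1/2$, and $F(x)$ has a density $\varrho$ that is even, continuous, strictly positive on $(-c,c)$, zero outside $(-c,c)$, with $\lim_{x\to c}\varrho(x)/|c-x|^{\kappa}=q$. A lazy walk of length $n$ is $\gamma:\{0,\dots,n\}\to\mathbb Z$ with $|\gamma(i+1)-\gamma(i)|\le1$; its action is $A(B,F;\gamma)=\sum_{i=1}^nB(i)F(\gamma(i))$. The discrepancy of the edge $\{x,x+1\}$ is $d(x)=2c-|F(x+1)-F(x)|$. Let $\zeta=\frac{2\kappa+2}{2\kappa+3}$. *)

(* Defs.v *)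
From HB Require Import structures.
From mathcomp Require Import all_boot all_order all_algebra.
From mathcomp Require Import all_classical all_reals all_analysis.
Set Implicit Arguments. Unset Strict Implicit. Unset Printing Implicit Defensive.
Import Order.TTheory GRing.Theory Num.Theory.
Import numFieldNormedType.Exports.
Local Open Scope classical_set_scope.
Local Open Scope ring_scope.

Section Defs.
Context {R : realType}.

(* Walks are functions nat -> int; only the values on {0,...,n} matter. *)
Definition lazy_walk (n : nat) (g : nat -> int) : Prop :=
  forall i : nat, (i < n)%N -> `|g i.+1 - g i| <= 1.

Definition action (Bv : int -> R) (Fv : int -> R) (n : nat) (g : nat -> int) : R :=
  \sum_(1 <= i < n.+1) Bv (i%:Z) * Fv (g i).

Definition minimizing_walk (Bv Fv : int -> R) (n : nat) (g : nat -> int) : Prop :=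
  [/\ g 0%N = 0, lazy_walk n g &
      forall g' : nat -> int, g' 0%N = 0 -> lazy_walk n g' ->
        action Bv Fv n g <= action Bv Fv n g'].

Definition walk_range (n : nat) (g : nat -> int) : set int :=
  [set x | exists2 i : nat, (i <= n)%N & g i = x].

Definition discrepancy (c : R) (Fv : int -> R) (x : int) : R :=
  2 * c - `|Fv (x + 1) - Fv x|.

Definition is_argmin_discrepancy (c : R) (Fv : int -> R) (n : nat)
    (g : nat -> int) (l : int) : Prop :=
  walk_range n g l /\
  forall x, walk_range n g x -> discrepancy c Fv l <= discrepancy c Fv x.

(* tau = min { i : g(i) in {l, l+1} } (equals n+1 if never hit before n) *)
Definition hit_time (n : nat) (g : nat -> int) (l : int) : nat :=
  find (fun i => (g i == l) || (g i == l + 1)) (iota 0 n.+1).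

Definition stays_after_hit (n : nat) (g : nat -> int) (l : int) : Prop :=
  forall i : nat, (hit_time n g l <= i)%N -> (i <= n)%N ->
    (g i == l) || (g i == l + 1).

End Defs.

Section Prob.
Context {R : realType} {d : measure_display} {T : measurableType d}.
Local Open Scope ereal_scope.

Definition mutually_independent (P : probability T R) {I : choiceType}
    (X : I -> T -> R) : Prop :=
  forall (J : seq I) (A : I -> set R), uniq J ->
    (forall i, i \in J -> measurable (A i)) ->
    P (\bigcap_(i in [set` J]) (X i @^-1` A i)) =
    \prod_(i <- J) P (X i @^-1` A i).

(* "P(S) >= r" for a possibly non-measurable event S, read as inner
   probability: some measurable subset of S has probability >= r *)
Definition prob_ge (P : probability T R) (S : set T) (r : R) : Prop :=
  exists2 E : set T, measurable E & (E `<=` S /\ r%:E <= P E).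

End Prob.

(* Main.v *)
Require Import Defs.
From HB Require Import structures.
From mathcomp Require Import all_boot all_order all_algebra.
From mathcomp Require Import all_classical all_reals all_analysis.
From mathcomp Require Import measurable_realfun.
From mathcomp Require Import zify ring lra.
Set Implicit Arguments. Unset Strict Implicit. Unset Printing Implicit Defensive.
Import Order.TTheory GRing.Theory Num.Theory.
Import numFieldNormedType.Exports.
Local Open Scope classical_set_scope.
Local Open Scope ring_scope.

(* Writing gap x = c - |F x|, the quantity c n + A is a sum of nonnegative step costs
   c + B(i) F(x_i) >= gap x_i. With dl = n^(zeta - 1) and L = n dl = n^zeta, discrepancies
   d(x) <= t have probability of order t^(2 kappa + 2) and L dl^(2 kappa + 2) = 1, so some
   edge at distance O(L) has d = O(dl); walking there and then always standing on the
   better endpoint costs O(L). Conversely, each new vertex visited costs its gap, so the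
   minimizer stays within O(L).

   Cut time into windows of length W = O(log n) in which both signs of B occur almost
   equally often, and call a gap small when it is below r = dl^(3/4) >> W dl. With high
   probability no three consecutive vertices within range have small gaps, so in a window
   the walk either pays r or remains on one edge x and pays about d(x) W / 2. This gives
   the lower bounds. The two smallest discrepancies in range moreover differ by eta dl;
   an excursion away from the best edge, once reached, pays r at its first step and at
   least as much as staying in each full window, so it is never optimal. *)

(** * Costs of walks in a fixed environment *)

(** The exponent 3/4 comes from a range. Of order L vertices are in play and a gap below dl^a has
    probability of order dl^(a (kappa + 1)), so three adjacent ones disappear as soon as 3 a > 2,
    while r must dominate W dl, that is a < 1. Two adjacent small gaps do occur: the best edge is
    such a pair.

    The separation eta dl has no power of n to spare. Order L^2 pairs of edges compete, and a pair
    has both discrepancies O(dl) with probability of order dl^(4 kappa + 4) = L^(-2), so a near tie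
    becomes unlikely only through a small constant eta. This fixes the precision asked of the signs:
    in a window of length k w the two counts may differ by w, and k is chosen after eta to make the
    relative error 1 / k harmless. Edges sharing a vertex with the best one have dependent
    discrepancies, but an excursion avoids both of its vertices, so only edges at distance at least
    2 have to be separated.

    All probabilistic input concerns the environment alone; the deterministic statements then hold
    for every minimizer and every argmin. *)

Section Deterministic.
Variables (R : realType) (c : R) (b f : int -> R).
Hypothesis f_le : forall x, `|f x| <= c.
Hypothesis b_sign : forall i, b i = 1 \/ b i = -1.

Definition gap (x : int) : R := c - `|f x|.
Definition step_cost (i : nat) (x : int) : R := c + b i%:Z * f x.
Definition cost (g : nat -> int) (s t : nat) : R :=
  \sum_(s <= i < t) step_cost i (g i).
Local Notation disc := (discrepancy c f).

Lemma gap_ge0 x : 0 <= gap x.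
Proof. by rewrite /gap subr_ge0. Qed.

Lemma gap_le_step_cost i x : gap x <= step_cost i x.
Proof.
rewrite /gap /step_cost lerD2l; have := ler_norm (f x); have := ler_norm (- f x).
rewrite normrN; case: (b_sign i%:Z) => ->; lra.
Qed.

Lemma step_cost_ge0 i x : 0 <= step_cost i x.
Proof. exact: le_trans (gap_ge0 x) (gap_le_step_cost i x). Qed.

Lemma gapD_le_disc x : gap x + gap (x + 1) <= disc x.
Proof.
rewrite /gap /discrepancy; have := ler_normB (f (x + 1)) (f x); lra.
Qed.

Lemma gap_le_disc x : gap x <= disc x /\ gap (x + 1) <= disc x.
Proof.
have := gapD_le_disc x; have := gap_ge0 x; have := gap_ge0 (x + 1); split; lra.
Qed.

(** Values of the same sign differ by at most [c]. A discrepancy below [c] thus forces opposite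
    signs, and then the difference has the sum of the two absolute values as its size. *)
Lemma disc_small x : disc x < c -> disc x = gap x + gap (x + 1).
Proof.
rewrite /gap /discrepancy; have := f_le x; have := f_le (x + 1).
by case: (ler0P (f x)); case: (ler0P (f (x + 1))); case: (ler0P (f (x + 1) - f x)); lra.
Qed.

Lemma cost_action n g : cost g 1 n.+1 = c * n%:R + action b f n g.
Proof.
rewrite /cost /action /step_cost big_split /=; congr (_ + _).
by rewrite sumr_const_nat subn1 /= mulr_natr.
Qed.

Lemma cost_ge0 g s t : 0 <= cost g s t.
Proof. by apply: sumr_ge0 => i _; exact: step_cost_ge0. Qed.

Lemma cost_cat g s u t : (s <= u)%N -> (u <= t)%N ->
  cost g s t = cost g s u + cost g u t.
Proof. by move=> su ut; rewrite /cost (big_cat_nat su ut). Qed.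

Lemma step_cost_le_cost g s t i : (s <= i < t)%N -> step_cost i (g i) <= cost g s t.
Proof.
move=> /andP[si it]; rewrite (cost_cat g si (ltnW it)) (cost_cat g (leqnSn i) it).
rewrite {2}/cost big_nat1; have := cost_ge0 g s i; have := cost_ge0 g i.+1 t; lra.
Qed.

(** The cheaper endpoint of the edge at time i. It depends on the sign B(i) only, and the endpoints
    are one step apart, so the greedy choice is itself a lazy walk. *)
Definition stay_pos (x : int) (i : nat) : int :=
  if b i%:Z == 1 then (if f x <= f (x + 1) then x else x + 1)
  else (if f x <= f (x + 1) then x + 1 else x).

Definition stay_plus (x : int) : R := c + Num.min (f x) (f (x + 1)).
Definition stay_minus (x : int) : R := c - Num.max (f x) (f (x + 1)).

Lemma stay_posE x i : step_cost i (stay_pos x i) =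
  if b i%:Z == 1 then stay_plus x else stay_minus x.
Proof.
have n1 : (-1 == 1 :> R) = false.
  by apply/negbTE; rewrite eq_sym -subr_eq0 opprK; apply: lt0r_neq0; lra.
rewrite /step_cost /stay_pos /stay_plus /stay_minus.
case: (b_sign i%:Z) => ->; first by rewrite eqxx mul1r; case: lerP.
by rewrite n1 mulN1r; case: lerP.
Qed.

Lemma stay_plus_minus x : stay_plus x + stay_minus x = disc x.
Proof.
rewrite /stay_plus /stay_minus /discrepancy.
by case: (lerP (f x) (f (x + 1))) => h; lra.
Qed.

Lemma stay_plus_ge0 x : 0 <= stay_plus x.
Proof.
rewrite /stay_plus; have := f_le x; have := f_le (x + 1); rewrite !ler_norml.
by case: (lerP (f x) (f (x + 1))); lra.
Qed.

Lemma stay_minus_ge0 x : 0 <= stay_minus x.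
Proof.
rewrite /stay_minus; have := f_le x; have := f_le (x + 1); rewrite !ler_norml.
by case: (lerP (f x) (f (x + 1))); lra.
Qed.

Lemma stay_cost_le x i : 0 <= step_cost i (stay_pos x i) <= disc x.
Proof.
rewrite step_cost_ge0 stay_posE -stay_plus_minus.
by have := stay_plus_ge0 x; have := stay_minus_ge0 x; case: ifP; lra.
Qed.

Lemma stay_pos_edge x i : stay_pos x i = x \/ stay_pos x i = x + 1.
Proof. by rewrite /stay_pos; case: ifP; case: ifP; [left|right|right|left]. Qed.

Lemma cost_stay_le x s t : cost (stay_pos x) s t <= (t - s)%:R * disc x.
Proof.
rewrite mulr_natl -sumr_const_nat; apply: ler_sum => i _.
by case/andP: (stay_cost_le x i).
Qed.

Definition nplus (s t : nat) : nat := (\sum_(s <= i < t) (b i%:Z == 1%R))%N.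
Definition nminus (s t : nat) : nat := (\sum_(s <= i < t) (b i%:Z != 1%R))%N.

Lemma nplus_minus s t : (nplus s t + nminus s t = t - s)%N.
Proof.
rewrite /nplus /nminus -big_split /= -[RHS]muln1 -sum_nat_const_nat.
by apply: eq_bigr => i _; case: (_ == _).
Qed.

Lemma sum_sign (A A' : R) s t :
  \sum_(s <= i < t) (if b i%:Z == 1 then A else A') =
  (nplus s t)%:R * A + (nminus s t)%:R * A'.
Proof.
rewrite /nplus /nminus !natr_sum !mulr_suml -big_split /=; apply: eq_bigr => i _.
by case: (_ == _); rewrite /= ?mul1r ?mul0r ?addr0 ?add0r.
Qed.

Lemma cost_stay x s t : cost (stay_pos x) s t =
  (nplus s t)%:R * stay_plus x + (nminus s t)%:R * stay_minus x.
Proof. by rewrite -sum_sign; apply: eq_bigr => i _; rewrite stay_posE. Qed.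

(* The running maximum grows by at most one, and a first visit to v costs at least gap v. *)
Lemma cost_ge_gaps g t : g 0%N = 0 -> lazy_walk t g ->
  forall m : nat, (exists2 i, (i <= t)%N & m%:Z <= g i) ->
  \sum_(1 <= v < m.+1) gap v%:Z <= cost g 1 t.+1.
Proof.
move=> g0; elim: t => [_ m [i i0 mi]|t IH lz m hm].
  have -> : m = 0%N by move: mi; rewrite (_ : i = 0%N) ?g0; lia.
  by rewrite big_geq ?cost_ge0.
have {}IH := IH (fun i (it : (i < t)%N) => lz i (ltnW it)).
have cS : cost g 1 t.+2 = cost g 1 t.+1 + step_cost t.+1 (g t.+1).
  by rewrite (@cost_cat g 1 t.+1) // /cost big_nat1.
case: (pselect (exists2 i, (i <= t)%N & m%:Z <= g i)) => [h|nh].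
  by rewrite cS; have := IH _ h; have := step_cost_ge0 t.+1 (g t.+1); lra.
have lt_m i : (i <= t)%N -> g i < m%:Z.
  by move=> it; rewrite ltNge; apply/negP => mi; apply: nh; exists i.
case: hm => i it1 mi.
have ei : i = t.+1 by case: (ltnP t i) => h; [lia | have := lt_m _ h; lia].
case: m => [|m] in nh lt_m mi *; first by exfalso; apply: nh; exists 0%N; rewrite ?g0.
have gt := lt_m t (leqnn t); have lzt := lz t (ltnSn t).
have em : g t.+1 = m.+1%:Z by move: lzt mi; rewrite ei; lia.
rewrite big_nat_recr //= cS em; apply: lerD; last exact: gap_le_step_cost.
by apply: IH; exists t => //; move: lzt; rewrite em; lia.
Qed.

(** Good vertices near the walk come in runs of at most two, and a lazy walk cannot jump to another
    run. The last alternative strengthens the induction: until the walk first moves, its edge may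
    still extend to either side. *)
Lemma confined_to_edge (good : int -> Prop) (g : nat -> int) u j :
  (forall i, (i < j)%N -> `|g (u + i).+1 - g (u + i)%N| <= 1) ->
  (forall i, (i <= j)%N -> good (g (u + i)%N)) ->
  (forall i x, (i <= j)%N -> `|x - g (u + i)%N| <= 2 ->
     ~ [/\ good x, good (x + 1) & good (x + 2)]) ->
  exists v, [/\ forall i, (i <= j)%N -> g (u + i)%N = v \/ g (u + i)%N = v + 1,
    good v & good (v + 1) \/ forall i, (i <= j)%N -> g (u + i)%N = v].
Proof.
elim: j => [_ hg _|j IH lz hg no3].
  exists (g (u + 0)%N); split; first by move=> i; rewrite leqn0 => /eqP->; left.
    exact: hg.
  by right=> i; rewrite leqn0 => /eqP->.
have [||i x ij hx|v [hv gv hv1]] := IH.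
- by move=> i ij; apply: lz; lia.
- by move=> i ij; apply: hg; lia.
- by apply: no3 hx; lia.
have lzj := lz j (ltnSn j); rewrite -addnS in lzj.
have gz := hg _ (leqnn j.+1); have no3j x := no3 j.+1 x (leqnn j.+1).
move: lzj gz no3j; set z := g (u + j.+1)%N => lzj gz no3j.
have ext (P : int -> Prop) : P z -> (forall i, (i <= j)%N -> P (g (u + i)%N)) ->
    forall i, (i <= j.+1)%N -> P (g (u + i)%N).
  by move=> Pz Pi i; rewrite leq_eqVlt => /orP[/eqP->|] //; exact: Pi.
case: hv1 => [gv1|allv]; last first.
  have gj := allv j (leqnn j); rewrite gj in lzj.
  have [ez|[ez|ez]] : z = v \/ (z = v + 1 \/ z + 1 = v) by lia.
  - exists v; split => //; last by right; exact: (ext (fun x => x = v)).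
    by apply: (ext (fun x => x = v \/ x = v + 1)) => [|i /allv]; left.
  - exists v; split => //; last by left; rewrite -ez.
    by apply: (ext (fun x => x = v \/ x = v + 1)) => [|i /allv]; [right|left].
  - exists z; split => //; last by left; rewrite ez.
    by apply: (ext (fun x => x = z \/ x = z + 1)) => [|i /allv ->]; [left|right].
exists v; split => //; last by left.
apply: (ext (fun x => x = v \/ x = v + 1)) => //.
have := hv j (leqnn j) => hj.
have [ez|[ez|[ez|ez]]] : z = v \/ (z = v + 1 \/ (z + 1 = v \/ z = v + 2)) by lia.
- by left.
- by right.
- by exfalso; apply: (no3j z); [lia|rewrite ez (_ : z + 2 = v + 1) //; lia].
- by exfalso; apply: (no3j v); [lia|rewrite -ez].
Qed.

Lemma minn_mul_le (A A' : R) (p m : nat) : 0 <= A -> 0 <= A' ->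
  (minn p m)%:R * (A + A') <= p%:R * A + m%:R * A'.
Proof.
by move=> A0 A'0; rewrite mulrDr lerD // ler_wpM2r // ler_nat ?geq_minl ?geq_minr.
Qed.

Lemma maxn_mul_ge (A A' : R) (p m : nat) : 0 <= A -> 0 <= A' ->
  p%:R * A + m%:R * A' <= (maxn p m)%:R * (A + A').
Proof.
by move=> A0 A'0; rewrite mulrDr lerD // ler_wpM2r // ler_nat ?leq_maxl ?leq_maxr.
Qed.

Lemma nplus_gt0 s t : (0 < nplus s t)%N -> exists2 i, (s <= i < t)%N & b i%:Z = 1.
Proof.
move=> h; apply: contrapT => ne; move: h; rewrite /nplus big_nat big1 // => i si.
by case: eqP => // bi; exfalso; apply: ne; exists i.
Qed.

Lemma nminus_gt0 s t : (0 < nminus s t)%N -> exists2 i, (s <= i < t)%N & b i%:Z = -1.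
Proof.
move=> h; apply: contrapT => ne; move: h; rewrite /nminus big_nat big1 // => i si.
by case: (b_sign i%:Z) => bi; rewrite ?bi ?eqxx //; exfalso; apply: ne; exists i.
Qed.

(** If every step costs less than [r], all visited vertices have small gaps and the walk is confined
    to one edge. When both signs occur, the sign of B dictates the vertex at each time, so the cost
    is known exactly. *)
Lemma window_cost g u W (r D : R) : r <= c -> 0 <= D ->
  (forall i, (u <= i)%N -> (i.+1 < u + W)%N -> `|g i.+1 - g i| <= 1) ->
  (forall i x, (u <= i < u + W)%N -> `|x - g i| <= 2 ->
     ~ [/\ gap x < r, gap (x + 1) < r & gap (x + 2) < r]) ->
  (forall i j, (u <= i < u + W)%N -> (u <= j < u + W)%N -> g j = g i + 1 ->
     D <= disc (g i)) ->
  Num.min r (D * (minn (nplus u (u + W)) (nminus u (u + W)))%:R) <= cost g u (u + W).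
Proof.
move=> rc D0 lz no3 hD.
case: (pselect (exists2 i, (u <= i < u + W)%N & r <= step_cost i (g i))).
  by case=> i ui ri; rewrite ge_min (le_trans ri) // step_cost_le_cost.
move=> nbad.
have cheap i : (u <= i < u + W)%N -> step_cost i (g i) < r.
  by move=> ui; rewrite ltNge; apply/negP => ri; apply: nbad; exists i.
(* If one sign is absent from the window, the minimum of the counts is 0 and the bound is
   trivial. *)
have [p0|p0] := posnP (nplus u (u + W)).
  by rewrite p0 min0n mulr0 ge_min cost_ge0 orbT.
have [m0|m0] := posnP (nminus u (u + W)).
  by rewrite m0 minn0 mulr0 ge_min cost_ge0 orbT.
have [i ui bi] := nplus_gt0 p0; have [j uj bj] := nminus_gt0 m0.
(* Since [r <= c], a step cheaper than [r] has B(t) and F(g t) of opposite signs. *)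
have fneg t : (u <= t < u + W)%N -> b t%:Z = 1 -> f (g t) < 0.
  by move=> ut bt; have := cheap t ut; rewrite /step_cost bt; lra.
have fpos t : (u <= t < u + W)%N -> b t%:Z = -1 -> 0 < f (g t).
  by move=> ut bt; have := cheap t ut; rewrite /step_cost bt; lra.
have [||t x tW|v [hv _ _]] :=
    @confined_to_edge (fun x => gap x < r) g u W.-1.
- by move=> t tW; apply: lz; lia.
- by move=> t tW; apply: le_lt_trans (gap_le_step_cost _ _) (cheap _ _); lia.
- by apply: no3; lia.
have {}hv t : (u <= t < u + W)%N -> g t = v \/ g t = v + 1.
  by move=> ut; have := hv (t - u)%N; rewrite subnKC; [apply; lia|lia].
rewrite ge_min; apply/orP; right.
have fi := fneg _ ui bi; have fj := fpos _ uj bj.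
(* F is negative at [g i] and positive at [g j], so these are the two different endpoints; [hD]
   applies and the two step costs add up to the discrepancy. *)
have key : D <= (c + f (g i)) + (c - f (g j)).
  case: (hv i ui) (hv j uj) => [ei|ei] [ej|ej]; rewrite ?ei ?ej in fi fj *; try lra.
    by have := hD i j ui uj; rewrite ei ej /discrepancy => /(_ erefl); rewrite gtr0_norm; lra.
  by have := hD j i uj ui; rewrite ei ej /discrepancy => /(_ erefl); rewrite ltr0_norm; lra.
have -> : cost g u (u + W) = \sum_(u <= t < u + W)
    (if b t%:Z == 1 then c + f (g i) else c - f (g j)).
  rewrite /cost big_nat [RHS]big_nat; apply: eq_bigr => t ut; rewrite /step_cost.
  case: eqP => [bt|nbt].
    rewrite bt mul1r; congr (_ + f _); have := fneg _ ut bt.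
    by case: (hv i ui) (hv j uj) (hv t ut) => [ei|ei] [ej|ej] [et|et];
      rewrite ?ei ?ej ?et in fi fj * => // ?; exfalso; lra.
  have bt : b t%:Z = -1 by case: (b_sign t%:Z).
  rewrite bt mulN1r; congr (_ - f _); have := fpos _ ut bt.
  by case: (hv i ui) (hv j uj) (hv t ut) => [ei|ei] [ej|ej] [et|et];
    rewrite ?ei ?ej ?et in fi fj * => // ?; exfalso; lra.
rewrite sum_sign; apply: le_trans (minn_mul_le _ _ _ _).
- by rewrite mulrC ler_wpM2l.
- by have := f_le (g i); rewrite ler_norml; lra.
- by have := f_le (g j); rewrite ler_norml; lra.
Qed.

(** The budget [h] is left general for two uses: constant in [argmin_cost], and the cost of staying
    on the best edge in [localised]. The term [H] pays for the last, incomplete window. *)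
Lemma segment_cost g (h : nat -> R) W (H : R) s t : (0 < W)%N -> (s <= t)%N ->
  (forall u, (s <= u)%N -> (u + W <= t)%N ->
     \sum_(u <= i < u + W) h i <= cost g u (u + W)) ->
  (forall u, (s <= u)%N -> (u <= t)%N -> (t < u + W)%N -> \sum_(u <= i < t) h i <= H) ->
  \sum_(s <= i < t) h i <= cost g s t + H.
Proof.
move=> W0; elim: {s}(t - s)%N {-2}s (leqnn (t - s)) => [|l IH] s ls st full part.
  have -> : s = t by lia.
  rewrite big_geq //; have := cost_ge0 g t t; have := part t; rewrite big_geq //.
  by move=> /(_ _ _ _); rewrite -[X in (X < _)%N]addn0 ltn_add2l => h1 h2;
     have := h1 st (leqnn t) W0; lra.
have [tW|Wt] := ltnP t (s + W).
  by have := part s (leqnn _) st tW; have := cost_ge0 g s t; lra.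
rewrite (@cost_cat g s (s + W)) ?leq_addr //.
rewrite (@big_cat_nat _ _ _ (s + W)) ?leq_addr //=.
have := full s (leqnn _) Wt.
have := IH (s + W)%N _ Wt; have aux : (t - (s + W) <= l)%N by lia.
move=> /(_ aux) {}IH; have h3 : \sum_(s + W <= i < t) h i <= cost g (s + W) t + H.
  by apply: IH => u su; [apply: full; lia|apply: part; lia].
by lra.
Qed.

(** [w] is the tolerance and [k * w] the length: [k] sets the relative precision, and a large [w]
    makes failure unlikely. *)
Definition balanced (k w u : nat) : Prop :=
  (nplus u (u + k * w) <= nminus u (u + k * w) + w)%N /\
  (nminus u (u + k * w) <= nplus u (u + k * w) + w)%N.

Lemma minimal_cost n g g' : minimizing_walk b f n g -> g' 0%N = 0 ->
  lazy_walk n g' -> cost g 1 n.+1 <= cost g' 1 n.+1.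
Proof. by case=> _ _ gm g0 lz; rewrite !cost_action lerD2l gm. Qed.

Lemma minimal_cost_le_straight n g (x0 : nat) : minimizing_walk b f n g ->
  (x0 <= n)%N -> cost g 1 n.+1 <= 2 * c * x0%:R + n%:R * disc x0%:Z.
Proof.
move=> gm x0n.
pose g' (i : nat) : int := if (i <= x0)%N then i%:Z else stay_pos x0%:Z i.
have lz : lazy_walk n g'.
  move=> i _; rewrite /g'; case: (ltnP i x0) => h; first by rewrite (ltnW h); lia.
  move: (stay_pos_edge x0%:Z i.+1) (stay_pos_edge x0%:Z i).
  by case: (leqP i x0) => h' e1 e2; lia.
apply: le_trans (minimal_cost gm _ lz) _; first by [].
have x1 : (1 <= x0.+1)%N by [].
rewrite (@cost_cat g' 1 x0.+1) // lerD //.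
  rewrite mulr_natr; have {2}-> : x0 = (x0.+1 - 1)%N by rewrite subn1.
  rewrite -sumr_const_nat; apply: ler_sum => i _; rewrite /step_cost.
  have := f_le (g' i); rewrite ler_norml.
  by case: (b_sign i%:Z) => ->; lra.
have -> : cost g' x0.+1 n.+1 = cost (stay_pos x0%:Z) x0.+1 n.+1.
  rewrite /cost big_nat [RHS]big_nat; apply: eq_bigr => i /andP[xi _].
  by rewrite /g' leqNgt xi.
apply: le_trans (cost_stay_le _ _ _) _; rewrite ler_wpM2r ?ler_nat ?leq_subr //; last lia.
by case/andP: (stay_cost_le x0%:Z 0); apply: le_trans.
Qed.

End Deterministic.

(** Reaching [M] would cost the gaps of all vertices on the way. The left side is the right side for
    the reflected walk in the reflected environment. *)
Lemma walk_confined (R : realType) (c : R) (b f : int -> R) (n M : nat)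
    (g : nat -> int) (U : R) :
  (forall x, `|f x| <= c) -> (forall i, b i = 1 \/ b i = -1) ->
  g 0%N = 0 -> lazy_walk n g -> cost c b f g 1 n.+1 <= U ->
  U < \sum_(1 <= v < M.+1) gap c f v%:Z ->
  U < \sum_(1 <= v < M.+1) gap c f (- v%:Z) ->
  forall i, (i <= n)%N -> `|g i| < M%:Z.
Proof.
move=> hf hb g0 lz cU U1 U2 i iN.
have h1 : g i < M%:Z.
  rewrite ltNge; apply/negP => Mi; move: U1; apply/negP; rewrite -leNgt.
  by apply: le_trans cU; apply: cost_ge_gaps => //; exists i.
have h2 : - g i < M%:Z.
  rewrite ltNge; apply/negP => Mi; move: U2; apply/negP; rewrite -leNgt.
  apply: le_trans cU; have -> : cost c b f g 1 n.+1 =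
      cost c b (fun x => f (- x)) (fun i => - g i) 1 n.+1.
    by apply: eq_bigr => j _; rewrite /step_cost opprK.
  apply: (@cost_ge_gaps _ c b (fun x => f (- x))) => //.
  - by rewrite g0 oppr0.
  - by move=> j jn; rewrite -opprD normrN; exact: lz.
  - by exists i.
lia.
Qed.

(** [s.+1] is the first exit after [tau] and [t] the first return; [t = n.+1] encodes an excursion
    that never returns and matches the half-open range of [cost]. *)
Lemma excursion (inE : pred nat) (tau n i0 : nat) :
  inE tau -> (tau <= i0 <= n)%N -> ~~ inE i0 ->
  exists s t, [/\ (s.+1 < t <= n.+1)%N, inE s,
    forall j, (s < j < t)%N -> ~~ inE j & t = n.+1 \/ inE t].
Proof.
move=> tauE /andP[taui i0n] bad0.
have ex1 : exists j, (tau <= j)%N && ~~ inE j by exists i0; rewrite taui.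
case: (ex_minnP ex1) => s1 /andP[taus1 bads1] mins1.
have s1n : (s1 <= n)%N by apply: leq_trans i0n; apply: mins1; rewrite taui.
have s1_gt : (tau < s1)%N.
  by rewrite ltn_neqAle taus1 andbT; apply/eqP => e; move: bads1; rewrite -e tauE.
case: s1 => [//|s] in taus1 bads1 mins1 s1n s1_gt *.
have ex2 : exists j, (s < j)%N && ((j == n.+1) || inE j).
  by exists n.+1; rewrite eqxx andbT ltnS ltnW.
case: (ex_minnP ex2) => t /andP[st tE] mint.
exists s, t; split.
- apply/andP; split; last by apply: mint; rewrite eqxx andbT ltnS ltnW.
  rewrite ltn_neqAle st andbT; apply/eqP => e; move: tE; rewrite -e (negbTE bads1) orbF.
  by rewrite eqSS => /eqP e'; rewrite e' ltnn in s1n.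
- apply/negPn/negP => h; have := mins1 s; rewrite h andbT -ltnS s1_gt.
  by move=> /(_ isT); rewrite ltnn.
- move=> j /andP[sj jt]; apply/negP => h; have := mint j.
  by rewrite sj h orbT => /(_ isT); rewrite leqNgt jt.
- by case/orP: tE => [/eqP|]; [left|right].
Qed.

(** * Minimizers in a good environment *)

Section GoodEnvironment.
Variables (R : realType) (c : R) (b f : int -> R) (n k w M : nat) (r D0 : R).
Hypothesis f_le : forall x, `|f x| <= c.
Hypothesis b_sign : forall i, b i = 1 \/ b i = -1.
Hypothesis k_ge2 : (2 <= k)%N.
Hypothesis w_gt0 : (0 < w)%N.
Hypothesis r_le : r <= c.
Hypothesis D0_ge0 : 0 <= D0.
Hypothesis windows_cheap : ((k * w).+1)%:R * D0 < r.
Hypothesis no3 : forall x : int, `|x| <= M%:Z + 2 ->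
  ~ [/\ gap c f x < r, gap c f (x + 1) < r & gap c f (x + 2) < r].
Hypothesis bal : forall u, (u <= n)%N -> balanced b k w u.
Variables (g : nat -> int) (l : int).
Hypothesis g_min : minimizing_walk b f n g.
Hypothesis g_conf : forall i, (i <= n)%N -> `|g i| < M%:Z.
Hypothesis l_argmin : is_argmin_discrepancy c f n g l.
Local Notation disc := (discrepancy c f).
Local Notation W := (k * w)%N.

Let disc_ge0 x : 0 <= disc x.
Proof. by case: (gap_le_disc f_le x) => /(le_trans _) h _; apply: h; exact: gap_ge0. Qed.

Let WD0 : W%:R * D0 < r.
Proof. move: windows_cheap; rewrite -addn1 natrD mulrDl mul1r => h; have := D0_ge0; lra. Qed.

Lemma confined_window (D : R) u : (u + W <= n.+1)%N -> 0 <= D ->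
  (forall i j, (u <= i < u + W)%N -> (u <= j < u + W)%N -> g j = g i + 1 ->
     D <= disc (g i)) ->
  Num.min r (D * (minn (nplus b u (u + W)) (nminus b u (u + W)))%:R)
    <= cost c b f g u (u + W).
Proof.
move=> uW D0' hD; apply: window_cost => //.
  by case: g_min => _ lz _ i ui iW; apply: lz; lia.
move=> i x ui xi; apply: no3.
have i_n : (i <= n)%N by lia.
by have := g_conf i_n; lia.
Qed.

(** The discrepancy is truncated at [D0] so that a whole window at this rate costs less than [r];
    both arms of the minimum in [confined_window] are then large enough. The incomplete last window
    is charged [W D0]. *)
Lemma argmin_cost :
  n%:R * (Num.min (disc l) D0 / 4) <= cost c b f g 1 n.+1 + W%:R * D0.
Proof.
set D := Num.min _ _.
have DD0 : D <= D0 by rewrite /D ge_min lexx orbT.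
have D0' : 0 <= D by rewrite /D le_min disc_ge0.
have W0 : (0 < W)%N by rewrite muln_gt0; apply/andP; split => //; lia.
have -> : n%:R * (D / 4) = \sum_(1 <= i < n.+1) (D / 4).
  by rewrite sumr_const_nat subn1 mulr_natl.
apply: (segment_cost f_le b_sign (W := W)) => // u u1 uW; last first.
  rewrite sumr_const_nat -[X in X <= _]mulr_natl => h.
  apply: ler_pM => //; [lra|rewrite ler_nat; lia|lra].
rewrite sumr_const_nat addKn -[X in X <= _]mulr_natl.
apply: le_trans (confined_window uW D0' _); last first.
  move=> i j ui uj _; apply: (@le_trans _ _ (disc l)); first by rewrite /D ge_min lexx.
  by case: l_argmin => _; apply; exists i => //; lia.
rewrite le_min; apply/andP; split.
  apply: le_trans (ltW WD0); apply: ler_pM => //; lra.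
have h3 := nplus_minus b u (u + W).
(* The counts add up to [W] and differ by at most [w], which is at most [W / 2] as [k >= 2]; so each
   is at least [W / 4]. *)
have h4 : (W <= 4 * minn (nplus b u (u + W)) (nminus b u (u + W)))%N.
  have : (2 * w <= W)%N by rewrite leq_mul2r k_ge2 orbT.
  have un : (u <= n)%N by lia.
  by have [b1 b2] := bal un; move: b1 b2 h3; rewrite addKn; lia.
by move: h4; rewrite -(ler_nat R) natrM; nra.
Qed.

(** An excursion pays at least [r] at its first step. The greedy walk on the best edge, put in its
    place, pays at most [D0] there and afterwards exceeds the excursion by at most [W D0], the price
    of an incomplete window; by [windows_cheap] the total stays below [r]. In full windows
    [2 D0 <= eta (k - 1)] lets [eta] outweigh the imbalance of the signs. *)
Lemma localised (eta : R) : 0 <= eta -> disc l <= D0 -> 2 * D0 <= eta * (k%:R - 1) ->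
  (forall x y : int, `|x| <= M%:Z -> `|y| <= M%:Z -> 2 <= `|x - y| ->
     disc x <= D0 -> disc x <= disc y -> disc x + eta <= disc y) ->
  stays_after_hit n g l.
Proof.
move=> eta0 lD0 hk sep i0 hit_i0 i0n.
have [g0 lz _] := g_min; have [largmin_range largmin] := l_argmin.
have [il iln gil] := largmin_range.
pose inE i := (g i == l) || (g i == l + 1).
pose tau := hit_time n g l.
have has_tau : has inE (iota 0 n.+1).
  by apply/hasP; exists il; rewrite ?mem_iota // /inE gil eqxx.
have tau_n : (tau < n.+1)%N by move: has_tau; rewrite has_find size_iota.
have tauE : inE tau by have := nth_find 0%N has_tau; rewrite nth_iota.
apply/negPn/negP => bad0.
have hi0 : (tau <= i0 <= n)%N by rewrite hit_i0.
have [s [t [/andP[s1_t tn] preE out tE]]] := excursion tauE hi0 bad0.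
clear has_tau tau_n tauE hi0 hit_i0 i0n bad0 gil iln il tau => {i0}.
have st : (s < t)%N := ltnW s1_t; have sn : (s < n)%N by rewrite -ltnS (leq_trans s1_t).
have out_s := out s.+1; rewrite ltnSn s1_t in out_s; have {}out_s := out_s isT.
pose g' j : int := if (s < j < t)%N then stay_pos b f l j else g j.
have inEP j : inE j -> g j = l \/ g j = l + 1 by case/orP => /eqP ->; [left|right].
(* The replaced stretch starts right after a position on the edge, and it either ends right before
   one or lasts until time [n]. *)
have lz' : lazy_walk n g'.
  move=> j jn; have lzj := lz j jn; rewrite /g'.
  have e1 := stay_pos_edge b f l j; have e2 := stay_pos_edge b f l j.+1.
  have js : j = s -> g j = l \/ g j = l + 1 by move=> ->; exact: inEP.
  have jt : j.+1 = t -> g j.+1 = l \/ g j.+1 = l + 1.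
    by move=> jt; rewrite jt; case: tE => [e|/inEP //]; move: jn; rewrite -ltnS jt e ltnn.
  by clear - lzj e1 e2 js jt; case: ifPn => h1; case: ifPn => h2; lia.
have g'0 : g' 0%N = 0 by rewrite /g' ltn0.
have := minimal_cost c g_min g'0 lz'; apply/negP; rewrite -ltNge.
have split3 h : cost c b f h 1 n.+1 =
    cost c b f h 1 s.+1 + (cost c b f h s.+1 t + cost c b f h t n.+1).
  by rewrite (@cost_cat _ c b f h 1 s.+1) ?ltnS ?(ltnW sn) // (@cost_cat _ c b f h s.+1 t) // ltnW.
rewrite !split3.
have -> : cost c b f g' 1 s.+1 = cost c b f g 1 s.+1.
  rewrite /cost big_nat [RHS]big_nat; apply: eq_bigr => j /andP[_ h].
  by rewrite /g' ltnNge -ltnS h.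
have -> : cost c b f g' t n.+1 = cost c b f g t n.+1.
  rewrite /cost big_nat [RHS]big_nat; apply: eq_bigr => j /andP[h _].
  by rewrite /g' (ltnNge j) h andbF.
have -> : cost c b f g' s.+1 t = cost c b f (stay_pos b f l) s.+1 t.
  by rewrite /cost big_nat [RHS]big_nat; apply: eq_bigr => j h; rewrite /g' h.
rewrite ltrD2l ltrD2r.
have split2 h : cost c b f h s.+1 t = cost c b f h s.+1 s.+2 + cost c b f h s.+2 t.
  by rewrite -cost_cat.
rewrite !split2.
have one (h : nat -> int) : cost c b f h s.+1 s.+2 = step_cost c b f s.+1 (h s.+1).
  by rewrite /cost big_nat1.
rewrite !one.
have [gapl gapl1] := gap_le_disc f_le l.
have D0r : D0 < r.
  have : 1 * D0 <= (W.+1)%:R * D0 by apply: ler_wpM2r => //; rewrite ler1n.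
  by move: windows_cheap; lra.
have gl : gap c f l < r by apply: le_lt_trans gapl (le_lt_trans lD0 D0r).
have gl1 : gap c f (l + 1) < r by apply: le_lt_trans gapl1 (le_lt_trans lD0 D0r).
(* The first vertex outside is adjacent to the edge, whose two gaps are at most [D0 < r]; a third
   small gap next to them is impossible. *)
have first_bad : r <= step_cost c b f s.+1 (g s.+1).
  apply: le_trans (gap_le_step_cost c f b_sign _ _); rewrite leNgt; apply/negP => gs1.
  have lzs := lz s sn; have gs := inEP _ preE.
  have lM : `|l| < M%:Z by case: largmin_range => a an <-; exact: g_conf.
  have [nl nl1] : g s.+1 <> l /\ g s.+1 <> l + 1.
    by move: out_s; rewrite /inE negb_or => /andP[/eqP ? /eqP ?].
  have [e|e] : g s.+1 + 1 = l \/ g s.+1 = l + 2 by clear - lzs gs nl nl1; lia.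
    apply: (no3 (x := g s.+1)); first by clear - e lM; lia.
    have e2 : g s.+1 + 2 = l + 1 by rewrite -e -addrA.
    by rewrite e e2.
  apply: (no3 (x := l)); first by clear - lM; lia.
  by rewrite -e.
have h1 : step_cost c b f s.+1 (stay_pos b f l s.+1) <= D0.
  by case/andP: (stay_cost_le f_le b_sign l s.+1) => _ /le_trans; apply.
suff h2 : cost c b f (stay_pos b f l) s.+2 t <= cost c b f g s.+2 t + W%:R * D0.
  by move: windows_cheap; rewrite -addn1 natrD mulrDl mul1r; lra.
have W0 : (0 < W)%N by rewrite muln_gt0 w_gt0 (ltnW k_ge2).
apply: (segment_cost f_le b_sign (W := W)) => // u su.
  move=> uWt; have uWn := leq_trans uWt tn.
  have D0' : 0 <= disc l + eta by rewrite addr_ge0.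
  apply: le_trans (confined_window uWn D0' _); last first.
    move=> i j ui uj gij; apply: sep => //.
    + by case: l_argmin => -[a an <-] _; apply: ltW; exact: g_conf.
    + by apply: ltW; apply: g_conf; clear - uWt tn ui; lia.
    (* Both endpoints of the edge used here avoid [l] and [l + 1], so the two edges are disjoint and
       [sep] applies. *)
    + have hi : ~~ inE i by apply: out; clear - uWt su ui; lia.
      have hj : ~~ inE j by apply: out; clear - uWt su uj; lia.
      move: hi hj; rewrite /inE !negb_or gij => /andP[/eqP i1 /eqP i2] /andP[/eqP j1 /eqP j2].
      by clear - i1 i2 j1 j2; lia.
    + by apply: largmin; exists i => //; clear - uWt tn ui; lia.
  rewrite -/(cost c b f (stay_pos b f l) u (u + W)) cost_stay //.
  apply: le_trans (maxn_mul_ge _ _ (stay_plus_ge0 f_le l) (stay_minus_ge0 f_le l)) _.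
  rewrite stay_plus_minus.
  have un : (u <= n)%N by rewrite -ltnS (leq_trans _ tn) // (leq_trans _ uWt) // -[X in (X < _)%N]addn0 ltn_add2l.
  have [b1 b2] := bal un; have pm := nplus_minus b u (u + W); rewrite addKn in pm.
  set p := nplus _ _ _ in b1 b2 pm *; set m := nminus _ _ _ in b1 b2 pm *.
  rewrite le_min; apply/andP; split.
    apply: le_trans (ltW WD0); apply: ler_pM => //; rewrite ler_nat -pm; clear; lia.
  (* Staying costs at most [disc l * (k + 1) * w / 2], and the right side is at least
     [(disc l + eta) * (k - 1) * w / 2]; the difference is
     [w * (eta * (k - 1) - 2 * disc l) / 2]. *)
  have hmax : (2 * maxn p m <= (k + 1) * w)%N by rewrite mulnDl mul1n -pm; clear - b1 b2; lia.
  have hmin : ((k - 1) * w <= 2 * minn p m)%N by rewrite mulnBl mul1n -pm; clear - b1 b2; lia.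
  have hmax' : 2 * (maxn p m)%:R <= (k%:R + 1) * w%:R :> R.
    by rewrite -(ler_nat R) !natrM natrD in hmax.
  have hmin' : (k%:R - 1) * w%:R <= 2 * (minn p m)%:R :> R.
    by rewrite -(ler_nat R) !natrM natrB in hmin; [|exact: ltnW].
  have w0 : 0 <= w%:R :> R by [].
  have k1 : 0 <= k%:R - 1 :> R by rewrite subr_ge0 ler1n ltnW.
  have dl0 := disc_ge0 l.
  have a1 : disc l * (2 * (maxn p m)%:R) <= disc l * ((k%:R + 1) * w%:R) by apply: ler_wpM2l.
  have a2 : (disc l + eta) * ((k%:R - 1) * w%:R) <= (disc l + eta) * (2 * (minn p m)%:R).
    by apply: ler_wpM2l => //; lra.
  have a3 : 0 <= w%:R * (eta * (k%:R - 1) - 2 * disc l) by apply: mulr_ge0 => //; lra.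
  by lra.
move=> ut tW; rewrite -/(cost c b f (stay_pos b f l) u t).
apply: le_trans (cost_stay_le f_le b_sign _ _ _) _; apply: ler_pM => //.
by rewrite ler_nat leq_subLR ltnW.
Qed.

End GoodEnvironment.

(** * Outer probability and independence *)

Section OuterProbability.
Context {R : realType} {d : measure_display} {T : measurableType d}.
Variable P : probability T R.

(* Outer probability: events about arbitrarily selected minimizers need not be measurable. *)
Definition oprob_le (S : set T) (e : R) : Prop :=
  exists2 N : set T, measurable N & (S `<=` N /\ (P N <= e%:E)%E).

Lemma oprob_le_measurable S e : measurable S -> (P S <= e%:E)%E -> oprob_le S e.
Proof. by move=> mS Se; exists S => //; split. Qed.

Lemma oprob_leW (S S' : set T) (e e' : R) :
  S `<=` S' -> e' <= e -> oprob_le S' e' -> oprob_le S e.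
Proof.
move=> SS' ee' [N mN [S'N Ne]]; exists N => //; split; first exact: subset_trans S'N.
by apply: le_trans Ne _; rewrite lee_fin.
Qed.

Lemma oprob_le0 e : 0 <= e -> oprob_le set0 e.
Proof. by move=> e0; apply: oprob_le_measurable => //; rewrite measure0 lee_fin. Qed.

Lemma oprob_leU S S' e e' : oprob_le S e -> oprob_le S' e' ->
  oprob_le (S `|` S') (e + e').
Proof.
move=> [N mN [SN Ne]] [N' mN' [SN' Ne']]; exists (N `|` N'); first exact: measurableU.
split; first by apply: setUSS.
by apply: le_trans (measureU2 _ mN mN') _; rewrite EFinD leeD.
Qed.

Lemma oprob_le_bigU (I : eqType) (s : seq I) (S : I -> set T) (e : I -> R) :
  (forall i, i \in s -> oprob_le (S i) (e i)) ->
  oprob_le [set w | exists2 i, i \in s & S i w] (\sum_(i <- s) e i).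
Proof.
elim: s => [_|i s IH hs].
  by rewrite big_nil; apply: oprob_leW (oprob_le0 (lexx 0)) => // w [].
rewrite big_cons.
apply: (@oprob_leW _ (S i `|` [set w | exists2 i, i \in s & S i w]) _ (e i + \sum_(j <- s) e j)) => //.
  by move=> w [j]; rewrite inE => /orP[/eqP ->|js] h; [left|right; exists j].
apply: oprob_leU; first by apply: hs; rewrite mem_head.
by apply: IH => j js; apply: hs; rewrite inE js orbT.
Qed.

Lemma oprob_le_const (I : eqType) (s : seq I) (S : I -> set T) (e : R) :
  (forall i, i \in s -> oprob_le (S i) e) ->
  oprob_le [set w | exists2 i, i \in s & S i w] ((size s)%:R * e).
Proof.
move=> h; have -> : (size s)%:R * e = \sum_(i <- s) e.
  by rewrite big_const_seq count_predT iter_addr_0 mulr_natl.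
exact: oprob_le_bigU.
Qed.

Lemma oprob_le_countable (S : int -> set T) :
  (forall x, oprob_le (S x) 0) -> oprob_le [set w | exists x, S x w] 0.
Proof.
move=> hS; have neg : P.-negligible (\bigcup_k (S k%:Z `|` S (- k%:Z))).
  apply: negligible_bigcup => k; case: (oprob_leU (hS k%:Z) (hS (- k%:Z))) => N mN [SN N0].
  exists N; split => //; apply/eqP; rewrite eq_le measure_ge0 andbT.
  by move: N0; rewrite addr0.
case: neg => N [mN N0 sN]; exists N => //; split; last by rewrite N0.
move=> w [x Sx]; apply: sN; exists (absz x) => //.
by case: (intP x) Sx => [|k|k] Sx; [left|left|right].
Qed.

Lemma prob_ge_compl (S : set T) (e : R) : oprob_le (~` S) e -> prob_ge P S (1 - e).
Proof.
move=> [N mN [SN Ne]]; exists (~` N); first exact: measurableC.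
split; first by apply: subsetCl.
by rewrite probability_setC // EFinB leeB.
Qed.

(** Markov's inequality for the number of events that occur, whose mean is at most [size s * theta];
    the events may be dependent. *)
Lemma oprob_le_half (I : eqType) (s : seq I) (E : I -> set T) (theta : R) :
  (forall i, measurable (E i)) -> (forall i, i \in s -> (P (E i) <= theta%:E)%E) ->
  (0 < size s)%N ->
  oprob_le [set w | (size s <= 2 * count (fun i => `[< E i w >]) s)%N] (2 * theta).
Proof.
move=> mE PE s0.
pose f w : R := \sum_(i <- s) \1_(E i) w.
have mf : measurable_fun setT f.
  by apply: measurable_sum => i; apply: measurable_indic.
pose N := [set w | (size s)%:R / 2 <= f w].
have mN : measurable N.
  rewrite (_ : N = setT `&` f @^-1` `[(size s)%:R / 2, +oo[%classic).
    by apply: mf => //; exact: measurable_itv.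
  by apply/seteqP; split => w /=; rewrite in_itv /= andbT; [split|case].
exists N => //; split.
  move=> w /= h; rewrite /N /= ler_pdivrMr //.
  have -> : f w = (count (fun i => `[< E i w >]) s)%:R.
    rewrite /f -sum1_count natr_sum [RHS]big_mkcond /=; apply: eq_bigr => i _.
    by rewrite indicE; case: asboolP => h'; [rewrite mem_set|rewrite memNset].
  by rewrite -natrM mulnC ler_nat.
have s20 : 0 < (size s)%:R / 2 :> R by rewrite divr_gt0 ?ltr0n.
have intf : (\int[P]_(w in setT) (f w)%:E <= ((size s)%:R * theta)%:E)%E.
  under eq_integral do rewrite /f -sumEFin.
  rewrite ge0_integral_sum //; last first.
    by move=> i; apply/measurable_EFinP; apply: measurable_indic.
  rewrite (_ : _ * theta = \sum_(i <- s) theta); last first.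
    by rewrite big_const_seq count_predT iter_addr_0 mulr_natl.
  rewrite -sumEFin big_seq [leRHS]big_seq; apply: lee_sum => i si.
  by rewrite integral_indic // setIT; exact: PE.
have : (((size s)%:R / 2)%:E * P N <= ((size s)%:R * theta)%:E)%E.
  apply: le_trans intf; rewrite -[in P N](setIT N) -integral_indic //.
  rewrite -ge0_integralZl //; last by apply/measurable_EFinP; apply: measurable_indic.
  apply: ge0_le_integral => //.
  - apply: (measurableT_comp (f := EFin) (g := fun w => (size s)%:R / 2 * \1_N w)) => //.
    by apply: measurable_funM => //; apply: measurable_indic.
  - by apply/measurable_EFinP.
  - move=> w _; rewrite -EFinM lee_fin indicE.
    have [Nw|Nw] := boolP (w \in N); first by rewrite mulr1; move: Nw; rewrite inE.
    by rewrite mulr0; apply: sumr_ge0 => i _.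
have PN : P N \is a fin_num by apply: fin_num_measure.
rewrite -(fineK PN) -EFinM !lee_fin => h.
have : 0 <= (size s)%:R * (2 * theta - fine (P N)) by lra.
by rewrite pmulr_rge0 ?ltr0n // subr_ge0.
Qed.

End OuterProbability.

Section Independence.
Context {R : realType} {d : measure_display} {T : measurableType d}.
Variables (P : probability T R) (I : choiceType) (X : I -> T -> R).
Hypothesis indep : mutually_independent P X.
Hypothesis mX : forall i, measurable_fun setT (X i).

Definition rect (s : seq (I * set R)) : set T :=
  [set w | forall p, p \in s -> p.2 (X p.1 w)].

Lemma measurable_preimage i (A : set R) : measurable A -> measurable (X i @^-1` A).
Proof. by move=> mA; rewrite -[_ @^-1` _]setTI; exact: mX. Qed.

Lemma rect_cons p s : rect (p :: s) = (X p.1 @^-1` p.2) `&` rect s.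
Proof.
apply/seteqP; split => [w h|w [hp h] p'].
  by split; [apply: h; rewrite mem_head|move=> p' p's; apply: h; rewrite inE p's orbT].
by rewrite inE => /orP[/eqP ->|]; [|exact: h].
Qed.

Lemma measurable_rect s : (forall p, p \in s -> measurable p.2) -> measurable (rect s).
Proof.
elim: s => [_|p s IH h]; first by rewrite (_ : rect _ = setT) //; apply/seteqP; split.
rewrite rect_cons; apply: measurableI.
  by apply: measurable_preimage; apply: h; rewrite mem_head.
by apply: IH => p' p's; apply: h; rewrite inE p's orbT.
Qed.

Lemma prob_rect s : uniq (unzip1 s) -> (forall p, p \in s -> measurable p.2) ->
  P (rect s) = (\prod_(p <- s) P (X p.1 @^-1` p.2))%E.
Proof.
move=> us ms.
(* The list becomes a family over all indices with default [setT]; distinct keys make the lookup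
   return the listed set. *)
pose A k := nth setT (unzip2 s) (index k (unzip1 s)).
have As p : p \in s -> A p.1 = p.2.
  rewrite /A; elim: s us {ms A} => // p0 s IH /= /andP[p0s us].
  rewrite inE => /orP[/eqP ->|ps]; first by rewrite eqxx.
  case: eqP => [e|_]; last exact: IH.
  by move: p0s; rewrite e (map_f fst ps).
have mA k : k \in unzip1 s -> measurable (A k).
  by case/mapP => p ps ->; rewrite As //; exact: ms.
have := indep us mA; rewrite big_map => H.
rewrite (_ : rect s = \bigcap_(i in [set` unzip1 s]) (X i @^-1` A i)).
  by rewrite H big_seq [RHS]big_seq; apply: eq_bigr => p ps; rewrite As.
apply/seteqP; split => w.
  by move=> h k /= /mapP[p ps ->]; rewrite /= As //; exact: h.
by move=> h p ps; rewrite -As //; apply: h => /=; exact: map_f.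
Qed.

Lemma oprob_le_rect (s : seq (I * set R * R)) : uniq [seq t.1.1 | t <- s] ->
  (forall t, t \in s -> measurable t.1.2 /\ (P (X t.1.1 @^-1` t.1.2) <= t.2%:E)%E) ->
  oprob_le P [set w | forall t, t \in s -> t.1.2 (X t.1.1 w)] (\prod_(t <- s) t.2).
Proof.
move=> us hs.
have ms p : p \in unzip1 s -> measurable p.2.
  by case/mapP => t ts ->; case: (hs t ts).
exists (rect (unzip1 s)); first exact: measurable_rect.
split; first by move=> w h p /mapP[t ts ->]; exact: h.
rewrite prob_rect //; last by rewrite /unzip1 -map_comp.
rewrite big_map; elim: s hs {us ms} => [|t s IH] hs; first by rewrite !big_nil.
rewrite !big_cons EFinM; have [_ h] := hs t (mem_head _ _).
apply: lee_pmul => //.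
  by elim/big_ind: _ => // x y; exact: mule_ge0.
by apply: IH => t' t's; apply: hs; rewrite inE t's orbT.
Qed.

(** The extra rectangle [s] carries the induction on [m]: removing the last pair subtracts the
    probability of the same event with two more coordinates added to [s], so the product rule for
    rectangles suffices. *)
Lemma prob_no_pair (u v : nat -> I) (A A' : set R) (p : R) :
  injective u -> injective v -> (forall i j, u i != v j) ->
  measurable A -> measurable A' ->
  (forall j, (P (X (u j) @^-1` A) * P (X (v j) @^-1` A') = p%:E)%E) ->
  forall m s, uniq (unzip1 s) -> (forall q, q \in s -> measurable q.2) ->
  (forall j, (j < m)%N -> (u j \notin unzip1 s) && (v j \notin unzip1 s)) ->
  P (rect s `&` [set w | forall j, (j < m)%N -> ~ (A (X (u j) w) /\ A' (X (v j) w))]) =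
  (P (rect s) * ((1 - p) ^+ m)%:E)%E.
Proof.
move=> iu iv uv mA mA' hp m.
set S := fun m => [set w | forall j, (j < m)%N -> ~ (A (X (u j) w) /\ A' (X (v j) w))].
pose E j := (X (u j) @^-1` A) `&` (X (v j) @^-1` A').
have mE j : measurable (E j) by apply: measurableI; exact: measurable_preimage.
have SS n : S n.+1 = S n `\` E n.
  apply/seteqP; split => w.
    by move=> h; split => [j jn|[h1 h2]]; [apply: h; exact: ltnW|exact: (h n (ltnSn n))].
  move=> [h1 h2] j; rewrite ltnS leq_eqVlt => /orP[/eqP ->|]; last exact: h1.
  by move=> [? ?]; apply: h2.
have mS n : measurable (S n).
  elim: n => [|n IH]; last by rewrite SS; exact: measurableD.
  by rewrite (_ : S 0%N = setT) //; apply/seteqP; split.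
elim: m => [|m IH] s us ms hs.
  rewrite -[X in P (_ `&` X)]/(S 0%N) expr0 mule1 (_ : S 0%N = setT) ?setIT //; by apply/seteqP; split.
rewrite -[X in P (_ `&` X)]/(S m.+1) SS setIDA measureD; last 3 first.
- by apply: measurableI => //; exact: measurable_rect.
- by [].
- by apply: le_lt_trans (probability_le1 _ _) (ltry _); apply: measurableI => //; exact: measurable_rect.
have -> : rect s `&` S m `&` E m = rect ((u m, A) :: (v m, A') :: s) `&` S m.
  by rewrite !rect_cons /E /= setIC !setIA.
have /andP[us1 vs1] := hs m (ltnSn m).
have us2 : uniq (unzip1 ((u m, A) :: (v m, A') :: s)).
  by rewrite /= inE negb_or uv us1 vs1.
have ms2 q : q \in (u m, A) :: (v m, A') :: s -> measurable q.2.
  by rewrite !inE => /orP[/eqP ->|/orP[/eqP ->|/ms]].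
have {}IH s' : uniq (unzip1 s') -> (forall q, q \in s' -> measurable q.2) ->
    (forall j, (j < m)%N -> (u j \notin unzip1 s') && (v j \notin unzip1 s')) ->
    P (rect s' `&` S m) = (P (rect s') * ((1 - p) ^+ m)%:E)%E := IH s'.
have e1 : P (rect s `&` S m) = (P (rect s) * ((1 - p) ^+ m)%:E)%E.
  by apply: IH => // j jm; exact: hs (ltnW jm).
have e2 : P (rect ((u m, A) :: (v m, A') :: s) `&` S m) =
    (P (rect ((u m, A) :: (v m, A') :: s)) * ((1 - p) ^+ m)%:E)%E.
  apply: IH => // j jm; have /andP[h1 h2] := hs j (ltnW jm).
  rewrite /= !inE !negb_or h1 h2 uv (inj_eq iu) (inj_eq iv) (eq_sym (v j)) uv.
  by rewrite (ltn_eqF jm).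
transitivity (P (rect s `&` S m) - P (rect ((u m, A) :: (v m, A') :: s) `&` S m))%E => //.
rewrite e1 e2.
rewrite (prob_rect us2 ms2) !big_cons /= -(prob_rect us ms) muleA hp.
have Pfin : P (rect s) \is a fin_num by apply: fin_num_measure; exact: measurable_rect.
rewrite -(fineK Pfin) -!EFinM -EFinB; congr EFin; rewrite exprS; ring.
Qed.

End Independence.

(** * Bernoulli inequalities and the balance of signs in windows *)

Lemma bernoulli_ineq (R : realFieldType) (a : R) k : 0 <= a <= 1 ->
  1 - k%:R * a <= (1 - a) ^+ k.
Proof.
move=> /andP[a0 a1]; elim: k => [|k IH]; first by rewrite expr0; lra.
rewrite exprS -natr1; have : 0 <= (1 - a) * ((1 - a) ^+ k - (1 - k%:R * a)).
  by apply: mulr_ge0; lra.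
have : 0 <= k%:R * (a * a) by rewrite !mulr_ge0.
by lra.
Qed.

(** From [1 + J p <= (1 + p)^J] and [(1 - p^2)^J <= 1]. It serves as a rational substitute for the
    exponential bound on [(1 - p)^J]. *)
Lemma expr_le_inv (R : realFieldType) (p : R) J : 0 <= p <= 1 ->
  (1 - p) ^+ J * (1 + J%:R * p) <= 1.
Proof.
move=> /andP[p0 p1]; have h : 1 + J%:R * p <= (1 + p) ^+ J.
  elim: J => [|J IH]; first by rewrite expr0; lra.
  rewrite exprS -natr1; have : 0 <= (1 + p) * ((1 + p) ^+ J - (1 + J%:R * p)).
    by apply: mulr_ge0; lra.
  have : 0 <= J%:R * (p * p) by rewrite !mulr_ge0.
  by lra.
have q0 : 0 <= 1 - p by lra.
apply: le_trans (ler_wpM2l (exprn_ge0 J q0) h) _.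
by rewrite -exprMn exprn_ile1 //; have := mulr_ge0 p0 p0; have : p * p <= 1 * 1 by [apply: ler_pM]; lra.
Qed.

Section Windows.
Variable R : realType.

(* Exponential tilting of the uniform measure on sign patterns: each sign s gets
   weight (1 + y) / 2 and the other sign (1 - y) / 2. *)
Lemma tilted_weight (k w p m : nat) (y : R) : (0 < k)%N -> y = (4 * k%:R)^-1 ->
  (p + m = k * w)%N -> (m + w <= p)%N ->
  (1 + y / 2) ^+ w <= (1 + y) ^+ p * (1 - y) ^+ m.
Proof.
move=> k0 ey pm mp.
have kR : 1 <= k%:R :> R by rewrite ler1n.
have ky : k%:R * y = 4^-1 by rewrite ey; field; lra.
have y0 : 0 < y by rewrite ey invr_gt0; lra.
have y1 : y <= 4^-1 by rewrite -ky; have := ler_wpM2r (ltW y0) kR; lra.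
have yy0 : 0 <= y ^+ 2 <= 1.
  by rewrite exprn_ge0 ?exprn_ile1 //; lra.
have -> : p = (m + (p - m))%N by lia.
rewrite exprD mulrAC -exprMn (_ : (1 + y) * (1 - y) = 1 - y ^+ 2); last by ring.
(* The choice [k y = 1/4] makes the loss small against the gain: by Bernoulli [(1 - y^2)^k (1 + y)
   >= (1 - y/4) (1 + y) >= 1 + y/2]. *)
apply: (@le_trans _ _ ((1 - y ^+ 2) ^+ (k * w) * (1 + y) ^+ w)).
  rewrite exprM -exprMn lerXn2r ?nnegrE //; first by lra.
    by apply: mulr_ge0; [apply: exprn_ge0; lra|lra].
  have := bernoulli_ineq k yy0; rewrite expr2 mulrA ky => h.
  have : 0 <= ((1 - y * y) ^+ k - (1 - 4^-1 * y)) * (1 + y).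
    by apply: mulr_ge0; lra.
  have : 0 <= y * (4^-1 - y) by apply: mulr_ge0; lra.
  by lra.
apply: ler_pM; rewrite ?exprn_ge0 //; try lra.
  apply: ler_wiXn2l; [lra|lra|lia].
apply: ler_weXn2l; [lra|lia].
Qed.

(** Chernoff's bound as a change of measure: the tilted weights sum to 1 over all patterns, and on
    each pattern with too many [s] they exceed the uniform weight by a factor [(1 + y/2)^w]. *)
Lemma unbalanced_patterns (k w : nat) (s : bool) : (0 < k)%N ->
  \sum_(v : {ffun 'I_(k * w) -> bool} |
        (#|[pred i | v i != s]| + w <= #|[pred i | v i == s]|)%N)
     (2^-1) ^+ (k * w) <= ((1 + (4 * k%:R)^-1 / 2) ^- w : R).
Proof.
move=> k0; set y : R := (4 * k%:R)^-1; set W := (k * w)%N.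
have kR : 1 <= k%:R :> R by rewrite ler1n.
have y0 : 0 < y by rewrite invr_gt0; lra.
have y1 : y <= 1 by rewrite invf_le1; lra.
have lam0 : 0 < (1 + y / 2) ^+ w by rewrite exprn_gt0 //; lra.
rewrite -[leRHS]mul1r ler_pdivlMr // mulr_suml.
pose F (i : 'I_W) (t : bool) : R := if t == s then (1 + y) / 2 else (1 - y) / 2.
have tot : \sum_(v : {ffun 'I_W -> bool}) \prod_i F i (v i) = 1.
  rewrite -bigA_distr_bigA /= big1 // => i _; rewrite big_bool /F.
  by case: (s) => /=; lra.
rewrite -[leRHS]tot big_mkcond /=; apply: ler_sum => v _.
have prodE : \prod_i F i (v i) = (2^-1) ^+ W *
    ((1 + y) ^+ #|[pred i | v i == s]| * (1 - y) ^+ #|[pred i | v i != s]|).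
  rewrite (bigID (fun i => v i == s)) /=.
  rewrite (eq_bigr (fun _ => (1 + y) / 2)); last by move=> i vi; rewrite /F vi.
  rewrite [X in _ * X](eq_bigr (fun _ => (1 - y) / 2)); last first.
    by move=> i vi; rewrite /F (negbTE vi).
  rewrite !prodr_const !exprMn mulrACA -exprD mulrC; congr (_ ^+ _ * _).
  by rewrite -[RHS](card_ord W) -(cardC [pred i | v i == s]).
case: ifP => [hv|_]; last first.
  by rewrite prodE !mulr_ge0 ?exprn_ge0 //; lra.
rewrite prodE; apply: ler_wpM2l; first by apply: exprn_ge0; lra.
apply: (@tilted_weight k) => //.
by rewrite -[RHS](card_ord W) -(cardC [pred i | v i == s]).
Qed.

End Windows.

Section WindowsEvent.
Context {R : realType} {d : measure_display} {T : measurableType d}.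
Variables (P : probability T R) (X : int + int -> T -> R).
Hypothesis indep : mutually_independent P X.
Hypothesis mX : forall i, measurable_fun setT (X i).
Hypothesis sgnX : forall i, P (X (inr i) @^-1` [set 1]) = (1 / 2)%:E /\
  P (X (inr i) @^-1` [set -1]) = (1 / 2)%:E.

Lemma oprob_not_sign :
  oprob_le P [set w | exists i, ~ (X (inr i) w = 1 \/ X (inr i) w = -1)] 0.
Proof.
apply: oprob_le_countable => i.
have m1 : measurable (X (inr i) @^-1` [set 1]) by apply: measurable_preimage.
have m2 : measurable (X (inr i) @^-1` [set -1]) by apply: measurable_preimage.
apply: (@oprob_leW _ _ _ P _ (~` (X (inr i) @^-1` [set 1] `|` X (inr i) @^-1` [set -1])) _ 0) => //.
apply: oprob_le_measurable; first by apply: measurableC; exact: measurableU.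
have [h1 h2] := sgnX i.
rewrite probability_setC; last exact: measurableU.
rewrite measureU //; last first.
  apply/seteqP; split => // w [] /= -> /eqP; rewrite -subr_eq0 opprK.
  by rewrite (_ : 1 + 1 = 2%:R :> R) // pnatr_eq0.
rewrite [X in (1 - X)%E](_ : _ = (1 / 2 + 1 / 2)%:E); last by rewrite EFinD ; congr (_ + _)%E.
by rewrite -EFinB lee_fin; lra.
Qed.

Lemma oprob_pattern (u W : nat) (v : {ffun 'I_W -> bool}) :
  oprob_le P [set w | forall i : 'I_W,
      X (inr (u + i)%:Z) w = if v i then 1 else -1] (2^-1 ^+ W).
Proof.
pose t (i : 'I_W) : (int + int) * set R * R :=
  (inr (u + i)%:Z, [set (if v i then 1 else -1)], 2^-1).
have := @oprob_le_rect _ _ _ P _ X indep mX [seq t i | i <- enum 'I_W].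
rewrite big_map big_enum /= prodr_const card_ord => H.
apply: (oprob_leW _ (lexx _) (H _ _)).
- by move=> w h _ /mapP[i _ ->] /=; rewrite h.
- rewrite -map_comp map_inj_uniq ?enum_uniq // => i j [] /eqP.
  by rewrite eqn_add2l => /eqP /val_inj.
- move=> _ /mapP[i _ ->] /=; split => //.
  by have [h1 h2] := sgnX (u + i)%:Z; case: (v i); rewrite ?h1 ?h2 mul1r.
Qed.

Lemma nplus_card (b : int -> R) (u W : nat) (v : {ffun 'I_W -> bool}) :
  (forall i : 'I_W, v i = (b (u + i)%:Z == 1)) ->
  nplus b u (u + W) = #|[pred i | v i == true]| /\
  nminus b u (u + W) = #|[pred i | v i == false]|.
Proof.
move=> hv; split; rewrite /nplus /nminus -sum1_card [RHS]big_mkcond /=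
  -{1}[u]add0n big_addn addKn big_mkord; apply: eq_bigr => i _.
  by rewrite inE eqb_id hv addnC; case: (_ == _).
by rewrite inE eqbF_neg hv addnC; case: (_ == _).
Qed.

(** One family of patterns for each sign in excess. The null event of values other than 1 and -1 is
    added so that every remaining sample has a pattern. *)
Lemma oprob_unbalanced (k w u : nat) : (0 < k)%N ->
  oprob_le P [set om | ~ balanced (fun i => X (inr i) om) k w u]
    (2 * (1 + (4 * k%:R)^-1 / 2) ^- w).
Proof.
move=> k0; set lam := (_ ^- w); set W := (k * w)%N.
pose unb (s : bool) := [pred v : {ffun 'I_W -> bool} |
  (#|[pred i | v i != s]| + w <= #|[pred i | v i == s]|)%N].
pose S (v : {ffun 'I_W -> bool}) := [set om | forall i : 'I_W,
      X (inr (u + i)%:Z) om = if v i then 1 else -1].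
have Hs s : oprob_le P [set om | exists2 v, v \in enum (unb s) & S v om] lam.
  have := @oprob_le_bigU _ _ _ P _ (enum (unb s)) S (fun=> 2^-1 ^+ W)
    (fun v _ => oprob_pattern u v).
  apply: oprob_leW; first exact: subset_refl.
  by rewrite big_enum /=; exact: unbalanced_patterns.
have e2 : 2 * lam = 0 + (lam + lam) by rewrite add0r mulrDl mul1r.
rewrite e2; apply: (oprob_leW _ (lexx _) (oprob_leU oprob_not_sign (oprob_leU (Hs true) (Hs false)))).
move=> om nbal; case: (pselect (exists i, ~ (X (inr i) om = 1 \/ X (inr i) om = -1))).
  by left.
move=> sgn; right.
have {}sgn i : X (inr i) om = 1 \/ X (inr i) om = -1.
  by apply: contrapT => h; apply: sgn; exists i.
pose v : {ffun 'I_W -> bool} := [ffun i : 'I_W => X (inr (u + i)%:Z) om == 1].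
have Sv : S v om.
  by move=> i; rewrite ffunE; case: eqP => // h; case: (sgn (u + i)%:Z).
have [np nm] := @nplus_card (fun i => X (inr i) om) u W v (fun i => ffunE _ i).
have C s : #|[pred i | v i != s]| = #|[pred i | v i == ~~ s]|.
  by apply: eq_card => i; rewrite !inE; case: (v i); case: s.
have [h|h] : (nminus (fun i => X (inr i) om) u (u + W) + w <=
    nplus (fun i => X (inr i) om) u (u + W))%N \/
   (nplus (fun i => X (inr i) om) u (u + W) + w <=
    nminus (fun i => X (inr i) om) u (u + W))%N.
- case: (leqP (nminus (fun i => X (inr i) om) u (u + W) + w)
      (nplus (fun i => X (inr i) om) u (u + W))) => h; first by left.
  right; rewrite leqNgt; apply/negP => h'; apply: nbal; split; exact: ltnW.
- by left; exists v => //; rewrite mem_enum inE C /= -np -nm.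
- by right; exists v => //; rewrite mem_enum inE C /= -np -nm.
Qed.

End WindowsEvent.

(** * The law of the gaps *)

(** The exponent may have either sign, so the power may increase or decrease; the sum of the
    endpoint values covers both cases. *)
Lemma powR_le_sum (R : realType) (k a b t : R) : 0 < a -> a <= t -> t <= b ->
  t `^ k <= a `^ k + b `^ k.
Proof.
move=> a0 ta tb; have [k0|k0] := leP 0 k.
  have : t `^ k <= b `^ k by apply: ge0_ler_powR; rewrite ?nnegrE //; lra.
  by have := powR_ge0 a k; lra.
have : t `^ k <= a `^ k.
  rewrite -[k]opprK (powRN t) (powRN a) lef_pV2 ?posrE ?powR_gt0 //; try lra.
  by apply: ge0_ler_powR; rewrite ?nnegrE; lra.
by have := powR_ge0 b k; lra.
Qed.

Lemma powR_ge_min (R : realType) (k a b t : R) : 0 < a -> a <= t -> t <= b ->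
  Num.min (a `^ k) (b `^ k) <= t `^ k.
Proof.
move=> a0 ta tb; rewrite ge_min; have [k0|k0] := leP 0 k.
  by apply/orP; left; apply: ge0_ler_powR; rewrite ?nnegrE //; lra.
apply/orP; right.
rewrite -[k]opprK (powRN t) (powRN b) lef_pV2 ?posrE ?powR_gt0 //; try lra.
by apply: ge0_ler_powR; rewrite ?nnegrE; lra.
Qed.

Section Density.
Context {R : realType} {d : measure_display} {T : measurableType d}.
Variables (P : probability T R) (F : int -> T -> R) (c q kappa : R) (rho : R -> R).
Hypothesis c_gt0 : 0 < c.
Hypothesis q_gt0 : 0 < q.
Hypothesis kappa_gt : -1 < kappa.
Hypothesis rho_even : forall x : R, rho (- x) = rho x.
Hypothesis rho_cont : {in `]- c, c[, continuous rho}.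
Hypothesis rho_pos : forall x : R, - c < x < c -> 0 < rho x.
Hypothesis rho_out : forall x : R, ~ (- c < x < c) -> rho x = 0.
Hypothesis rho_edge : (fun x => rho x / (c - x) `^ kappa) @ c^'- --> q.
Hypothesis mF : forall x, measurable_fun setT (F x).
Hypothesis F_density : forall x (A : set R), measurable A ->
  P (F x @^-1` A) = (\int[lebesgue_measure]_(y in A) (rho y)%:E)%E.

Lemma rho_near_edge : exists2 t0, 0 < t0 < c & forall u, 0 < u < t0 ->
  q / 2 * u `^ kappa <= rho (c - u) <= 2 * q * u `^ kappa.
Proof.
have q2 : 0 < q / 2 by rewrite divr_gt0.
have /= := (@cvgrPdist_lt _ _ _ _ _ _ _).1 rho_edge _ q2.
rewrite near_withinE => -[e /= e0 he].
exists (Num.min e (c / 2)).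
  have c2 : c / 2 < c by rewrite ltr_pdivrMr // ltr_pMr // ltr1n.
  by rewrite lt_min e0 divr_gt0 //= gt_min c2 orbT.
move=> u; rewrite lt_min => /andP[u0 /andP[ue uc]].
have uk : 0 < u `^ kappa by rewrite powR_gt0.
have := he (c - u); rewrite /= opprB addrC subrK ger0_norm ?(ltW u0) // => /(_ ue).
rewrite ltrBlDr ltrDl u0 => /(_ isT).
rewrite ltr_norml => /andP[h1 h2].
have e1 : rho (c - u) = rho (c - u) / u `^ kappa * u `^ kappa.
  by rewrite divfK // gt_eqF.
rewrite e1; set z := rho (c - u) / u `^ kappa in h1 h2 *.
by apply/andP; split; apply: ler_wpM2r; lra.
Qed.

Lemma measurable_rho (x y : R) : - c < x -> y < c -> measurable_fun `[x, y]%classic (EFin \o rho).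
Proof.
move=> cx yc; apply/measurable_EFinP; apply: subspace_continuous_measurable_fun => //.
apply: continuous_in_subspaceT => z; rewrite inE /= in_itv /= => /andP[xz zy].
by apply: rho_cont; rewrite in_itv /= (lt_le_trans cx xz) (le_lt_trans zy yc).
Qed.

Lemma prob_itv_le x (a b M : R) : - c < a -> b < c -> a <= b ->
  (forall y : R, a <= y <= b -> rho y <= M) ->
  (P (F x @^-1` `[a, b]%classic) <= (M * (b - a))%:E)%E.
Proof.
move=> ca bc ab hM; rewrite F_density; last exact: measurable_itv.
apply: (@le_trans _ _ (\int[lebesgue_measure]_(y in `[a, b]) (M%:E))%E).
  apply: ge0_le_integral => //.
  - move=> y /=; rewrite in_itv /= => /andP[ay yb]; rewrite lee_fin ltW // rho_pos //.
    by rewrite (lt_le_trans ca ay) (le_lt_trans yb bc).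
  - exact: measurable_rho.
rewrite integral_cst //= lebesgue_measure_itv /= lte_fin.
have [h|h] := ltP a b; first by rewrite EFinM EFinB.
  have -> : b = a by apply/eqP; rewrite eq_le ab h.
  by rewrite subrr mulr0 mule0.
Qed.

Lemma prob_itv_ge x (a b M : R) : 0 <= M -> - c < a -> b < c -> a <= b ->
  (forall y : R, a <= y <= b -> M <= rho y) ->
  ((M * (b - a))%:E <= P (F x @^-1` `[a, b]%classic))%E.
Proof.
move=> M0 ca bc ab hM; rewrite F_density; last exact: measurable_itv.
apply: (@le_trans _ _ (\int[lebesgue_measure]_(y in `[a, b]) (M%:E))%E).
  rewrite integral_cst //= lebesgue_measure_itv /= lte_fin.
  have [h|h] := ltP a b; first by rewrite EFinM EFinB.
  have -> : b = a by apply/eqP; rewrite eq_le ab h.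
  by rewrite subrr mulr0 mule0.
apply: ge0_le_integral => //.
- exact: measurable_rho.
Qed.

Lemma prob_outside x : P (F x @^-1` [set y | c <= `|y|]) = 0%E.
Proof.
have mA : measurable [set y : R | c <= `|y|].
  rewrite (_ : [set _ | _] = setT `&` (fun y : R => `|y|) @^-1` `[c, +oo[%classic).
    by apply: normr_measurable.
  by apply/seteqP; split => y /=; rewrite in_itv /= andbT; [split|case].
rewrite F_density // integral0_eq // => y /= cy; rewrite rho_out //.
by move: cy; rewrite ler_normr; lra.
Qed.

Lemma measurable_gap_itv (I : interval R) : measurable [set y : R | c - `|y| \in I].
Proof.
rewrite (_ : [set _ | _] = setT `&` (fun y : R => c - `|y|) @^-1` [set` I]).
  by apply: measurable_funB => //; exact: normr_measurable.
by apply/seteqP; split => y //= [].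
Qed.

Definition gap_band (a b : R) : set R := [set y | a <= c - `|y| <= b].

Lemma measurable_gap_band a b : measurable (gap_band a b).
Proof.
rewrite (_ : gap_band a b = [set y | c - `|y| \in `[a, b]]); first exact: measurable_gap_itv.
by apply/seteqP; split => y; rewrite /gap_band /= in_itv.
Qed.

Lemma measurable_F_gap_band x a b : measurable (F x @^-1` gap_band a b).
Proof.
by rewrite -[_ @^-1` _]setTI; apply: mF => //; exact: measurable_gap_band.
Qed.

(** The band is an interval near [c] together with its mirror image near [-c], which has the same
    density by evenness. *)
Lemma prob_band x (a b t0 : R) :
  (forall u, 0 < u < t0 -> rho (c - u) <= 2 * q * u `^ kappa) -> t0 < c ->
  0 < a -> a <= b -> b < t0 ->
  (P (F x @^-1` gap_band a b) <=
    (4 * q * (b - a) * (a `^ kappa + b `^ kappa))%:E)%E.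
Proof.
have [c0 q0 k0] : [/\ 0 < c, 0 < q & -1 < kappa] by [].
move=> hr t0c a0 ab bt.
have mI (i : interval R) : measurable (F x @^-1` [set` i]).
  by rewrite -[_ @^-1` _]setTI; apply: mF.
have b_t u : a <= u <= b -> rho (c - u) <= 2 * q * (a `^ kappa + b `^ kappa).
  move=> /andP[au ub]; apply: le_trans (hr u _) _.
    by rewrite (lt_le_trans a0 au) (le_lt_trans ub bt).
  by apply: ler_wpM2l; [rewrite mulr_ge0 // ltW|exact: powR_le_sum].
set M := 2 * q * _ in b_t.
have h1 : (P (F x @^-1` `[(c - b)%R, (c - a)%R]%classic) <= (M * (c - a - (c - b)))%:E)%E.
  apply: prob_itv_le; [lra|lra|lra|].
  move=> y /andP[y1 y2]; rewrite (_ : y = c - (c - y)); last by ring.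
  by apply: b_t; apply/andP; split; lra.
have h2 : (P (F x @^-1` `[(a - c)%R, (b - c)%R]%classic) <= (M * (b - c - (a - c)))%:E)%E.
  apply: prob_itv_le; [lra|lra|lra|].
  move=> y /andP[y1 y2]; rewrite -rho_even (_ : - y = c - (c + y)); last by ring.
  by apply: b_t; apply/andP; split; lra.
apply: (@le_trans _ _ (P (F x @^-1` `[(c - b)%R, (c - a)%R]%classic `|`
    F x @^-1` `[(a - c)%R, (b - c)%R]%classic))).
  apply: le_measure; rewrite ?inE.
  - exact: measurable_F_gap_band.
  - by apply: measurableU.
  - move=> w /= /andP[]; case: (ler0P (F x w)) => _ h3 h4; [right|left];
      by rewrite in_itv /=; apply/andP; split; lra.
apply: le_trans (measureU2 _ (mI _) (mI _)) _.
apply: le_trans (leeD h1 h2) _; rewrite -EFinD lee_fin /M; lra.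
Qed.

(** The two ends are kept apart because a small discrepancy needs one value near [c] and the other
    near [-c]. Stopping at distance [t / 2] from the end keeps [u^kappa] comparable with [t^kappa]
    for either sign of [kappa]. *)
Lemma prob_edge_lower : exists2 C, 0 < C & exists2 t0, 0 < t0 & forall x t, 0 < t < t0 ->
  ((C * t `^ (kappa + 1))%:E <= P (F x @^-1` `[(c - t)%R, (c - t / 2)%R]%classic))%E /\
  ((C * t `^ (kappa + 1))%:E <= P (F x @^-1` `[(t / 2 - c)%R, (t - c)%R]%classic))%E.
Proof.
have [c0 q0 k0] : [/\ 0 < c, 0 < q & -1 < kappa] by [].
have [t0 /andP[t00 t0c] hr] := rho_near_edge.
pose m := Num.min (2^-1 `^ kappa) 1.
have m0 : 0 < m by rewrite lt_min ltr01 powR_gt0.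
exists (q / 4 * m); first by rewrite !mulr_gt0.
exists t0 => // x t /andP[tt0 tt].
have b_t u : t / 2 <= u <= t -> q / 2 * (m * t `^ kappa) <= rho (c - u).
  move=> /andP[u1 u2]; have u0 : 0 < u < t0 by apply/andP; split; lra.
  case/andP: (hr u u0) => h _; apply: le_trans h; apply: ler_wpM2l; first lra.
  have t20 : 0 < t / 2 by lra.
  apply: le_trans (powR_ge_min kappa t20 u1 u2).
  rewrite powRM; [|lra|lra]; rewrite le_min; apply/andP; split.
    by rewrite mulrC; apply: ler_wpM2l; rewrite ?powR_ge0 // /m ge_min lexx.
  rewrite -[leRHS]mul1r; apply: ler_wpM2r; first exact: powR_ge0.
  by rewrite /m ge_min lexx orbT.
have eC : q / 4 * m * t `^ (kappa + 1) = q / 2 * (m * t `^ kappa) * (t / 2).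
  rewrite powRD; last by apply/implyP => _; rewrite gt_eqF.
  by rewrite powRr1 ?ltW //; field.
have M0 : 0 <= q / 2 * (m * t `^ kappa).
  by rewrite !mulr_ge0 ?powR_ge0 ?(ltW m0) ?(ltW q_gt0).
rewrite eC; split.
  have -> : t / 2 = c - t / 2 - (c - t) :> R by field.
  have -> : c - (c - t / 2 - (c - t)) = c - t / 2 by field.
  apply: prob_itv_ge => //; [lra|lra|lra|].
  move=> y /andP[y1 y2]; rewrite (_ : y = c - (c - y)); last by ring.
  by apply: b_t; apply/andP; split; lra.
have -> : q / 2 * (m * t `^ kappa) * (t / 2) =
   q / 2 * (m * t `^ kappa) * (t - c - (t / 2 - c)) by field.
apply: prob_itv_ge => //; [lra|lra|lra|].
move=> y /andP[y1 y2]; rewrite -rho_even (_ : - y = c - (c + y)); last by ring.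
by apply: b_t; apply/andP; split; lra.
Qed.

Definition small_gap (t : R) : set R := [set y | c - `|y| <= t].

Lemma measurable_small_gap t : measurable (small_gap t).
Proof.
rewrite (_ : small_gap t = [set y | c - `|y| \in `]-oo, t]]); first exact: measurable_gap_itv.
by apply/seteqP; split => y; rewrite /small_gap /= in_itv.
Qed.

Lemma measurable_F_small_gap x t : measurable (F x @^-1` small_gap t).
Proof.
by rewrite -[_ @^-1` _]setTI; apply: mF => //; exact: measurable_small_gap.
Qed.

(** Continuity from above, the intersection being the null event [|F x| >= c]. This disposes of the
    remainder after finitely many halvings. *)
Lemma prob_small_gap_cvg0 x (t e : R) : 0 < t -> 0 < e ->
  exists m : nat, (P (F x @^-1` small_gap (t * 2^-1 ^+ m)) <= e%:E)%E.
Proof.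
move=> t0 e0; pose S m := F x @^-1` small_gap (t * 2^-1 ^+ m).
have S0 : P (\bigcap_m S m) = 0%E.
  rewrite -(prob_outside x); congr (P _); apply/seteqP; split => w.
    move=> h /=; rewrite leNgt; apply/negP => lt_c.
    have : exists m : nat, t * 2^-1 ^+ m < c - `|F x w|.
      exists (Num.bound (t / (c - `|F x w|))).
      set z := c - _; have z0 : 0 < z by rewrite subr_gt0.
      have := archi_boundP (ltW (divr_gt0 t0 z0)); set k := Num.bound _ => hk.
      rewrite exprVn ltr_pdivrMr ?exprn_gt0 // mulrC -ltr_pdivrMr //.
      apply: lt_le_trans hk _; rewrite -natrX ler_nat ltnW // ltn_expl //.
    by case=> m; rewrite ltNge => /negP; apply; exact: (h m).
  by move=> /= h m _; rewrite /S /= /small_gap /=; apply: le_trans (_ : 0 <= _);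
    rewrite ?subr_le0 // mulr_ge0 ?exprn_ge0 // ltW.
have : (fun m => P (S m)) @ \oo --> 0%E.
  rewrite -S0; apply: nonincreasing_cvg_mu.
  - by apply: le_lt_trans (probability_le1 _ _) (ltry _); exact: measurable_F_small_gap.
  - by move=> i; exact: measurable_F_small_gap.
  - by apply: bigcapT_measurable => i; exact: measurable_F_small_gap.
  - move=> i j ij; apply/subsetPset => w; rewrite /S /= /small_gap /= => h.
    apply: le_trans h _; apply: ler_wpM2l; first exact: ltW.
    by apply: ler_wiXn2l => //; lra.
move=> /fine_cvgP [_ /cvgrPdist_le /(_ e e0) [N _ /(_ N (leqnn N))]] /=.
rewrite sub0r normrN => h; exists N.
have PN : P (S N) \is a fin_num by apply: fin_num_measure; exact: measurable_F_small_gap.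
by rewrite -/(S N) -(fineK PN) lee_fin; apply: le_trans (ler_norm _) h.
Qed.

(* Dyadic decomposition of (0, t], whose bands (t/2, t] have mass O(t^(kappa+1)). *)
Lemma prob_small_gap : exists2 C, 0 < C & exists2 t0, 0 < t0 < c & forall x t, 0 < t < t0 ->
  (P (F x @^-1` small_gap t) <= (C * t `^ (kappa + 1))%:E)%E.
Proof.
have [c0 q0 k0] : [/\ 0 < c, 0 < q & -1 < kappa] by [].
have [t0 /andP[t00 t0c] hr] := rho_near_edge.
pose al : R := 2^-1 `^ (kappa + 1).
pose C1 := 2 * q * (2^-1 `^ kappa + 1).
have al0 : 0 < al by rewrite powR_gt0.
have al1 : al < 1.
  have <- : 1 `^ (kappa + 1) = 1 :> R by rewrite powR1.
  by apply: gt0_ltr_powR; rewrite ?nnegrE //; lra.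
have C10 : 0 < C1 by rewrite !mulr_gt0 // addr_gt0 // powR_gt0.
have al1' : 0 < 1 - al by lra.
exists (C1 / (1 - al)); first exact: divr_gt0.
exists t0; first by rewrite t00 t0c.
have step x t : 0 < t < t0 -> (P (F x @^-1` small_gap t) <=
   P (F x @^-1` small_gap (t / 2)) + (C1 * t `^ (kappa + 1))%:E)%E.
  move=> /andP[tp tt].
  have tk : t `^ (kappa + 1) = t * t `^ kappa.
    rewrite powRD; last by apply/implyP => _; rewrite gt_eqF.
    by rewrite powRr1 ?ltW // mulrC.
  have hb : (P (F x @^-1` gap_band (t / 2) t) <=
      (C1 * t `^ (kappa + 1))%:E)%E.
    have hr' u : 0 < u < t0 -> rho (c - u) <= 2 * q * u `^ kappa by case/hr/andP.
    apply: le_trans (prob_band x hr' t0c _ _ tt) _; [lra|lra|].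
    rewrite lee_fin tk powRM; [|lra|lra].
    by rewrite /C1; lra.
  apply: le_trans (leeD (lexx _) hb).
  apply: le_trans (measureU2 _ _ _); [|exact: measurable_F_small_gap|exact: measurable_F_gap_band].
  apply: le_measure; rewrite ?inE.
  - exact: measurable_F_small_gap.
  - apply: measurableU; [exact: measurable_F_small_gap|exact: measurable_F_gap_band].
  - move=> w; rewrite /small_gap /gap_band /= => h.
    by case: (leP (c - `|F x w|) (t / 2)) => h'; [left|right; rewrite h (ltW h')].
move=> x t /andP[tp tt].
(* A partial geometric sum of ratio [al], which is below 1 because [kappa > -1]. *)
have iter m : (P (F x @^-1` small_gap t) <= P (F x @^-1` small_gap (t * 2^-1 ^+ m)) +
    (C1 * t `^ (kappa + 1) / (1 - al) * (1 - al ^+ m))%:E)%E.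
  elim: m => [|m IH]; first by rewrite !expr0 mulr1 subrr mulr0 adde0.
  apply: le_trans IH _.
  have ht : 0 < t * 2^-1 ^+ m < t0.
    rewrite mulr_gt0 ?exprn_gt0 //=; apply: le_lt_trans tt.
    by rewrite ler_piMr ?exprn_ile1 ?(ltW tp) //; lra.
  apply: le_trans (leeD (step x _ ht) (lexx _)) _.
  rewrite exprSr mulrA -addeA leeD // -EFinD lee_fin.
  have -> : (t * 2^-1 ^+ m) `^ (kappa + 1) = t `^ (kappa + 1) * al ^+ m.
    rewrite powRM ?exprn_ge0 ?(ltW tp) //; congr (_ * _).
    have h2 : 0 <= 2^-1 :> R by [].
    by rewrite -(powR_mulrn m h2) -powRrM mulrC powRrM powR_mulrn // powR_ge0.
  rewrite exprS le_eqVlt; apply/orP; left; apply/eqP; field.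
  by rewrite gt_eqF.
apply/lee_addgt0Pr => e e0.
have [m hm] := prob_small_gap_cvg0 x tp e0.
apply: le_trans (iter m) _; rewrite addeC; apply: leeD => //.
rewrite lee_fin.
rewrite -[leRHS]mulr1 [C1 / _ * _]mulrAC; apply: ler_wpM2l.
  by rewrite !mulr_ge0 ?powR_ge0 ?invr_ge0 // ltW.
by have := exprn_gt0 m al0; lra.
Qed.

(** The density may blow up at gap 0, so short bands are treated in two ways. A band starting below
    [sg * dl] lies among the gaps up to [2 * sg * dl], of mass at most [e * dl^(kappa + 1)] by the
    choice of [sg]. Above [sg * dl] the density is O(dl^kappa), and a small [eta] makes the length
    win. *)
Lemma prob_gap_concentration (K e : R) : 0 < K -> 0 < e ->
  exists2 eta, 0 < eta <= 1 & exists2 dl0, 0 < dl0 & forall x dl a b,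
    0 < dl < dl0 -> b <= K * dl -> b - a <= 4 * eta * dl ->
    (P (F x @^-1` gap_band a b) <= (e * dl `^ (kappa + 1))%:E)%E.
Proof.
move=> K0 e0; have [c0 q0 k0] : [/\ 0 < c, 0 < q & -1 < kappa] by [].
have [t0 /andP[t00 t0c] hr] := rho_near_edge.
have {}hr u : 0 < u < t0 -> rho (c - u) <= 2 * q * u `^ kappa by case/hr/andP.
have [C C0 [t1 /andP[t10 t1c] hC]] := prob_small_gap.
have bt0 : 0 < kappa + 1 by lra.
have [sg sg0 hsg] : exists2 sg, 0 < sg & C * (2 * sg) `^ (kappa + 1) = e.
  exists ((e / C) `^ (kappa + 1)^-1 / 2).
    by rewrite divr_gt0 // powR_gt0 // divr_gt0.
  rewrite mulrC mulrC [2 * _]mulrC divfK // -powRrM mulVf ?gt_eqF //.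
  by rewrite powRr1 ?divr_ge0 ?ltW // mulrC divfK // gt_eqF.
pose S := sg `^ kappa + K `^ kappa.
have S0 : 0 < S by rewrite addr_gt0 // powR_gt0.
pose eta := Num.min 1 (Num.min (sg / 4) (e / (32 * q * S))).
have D0 : 0 < 32 * q * S by apply: mulr_gt0 => //; apply: mulr_gt0.
have eta0 : 0 < eta by rewrite !lt_min ltr01 (divr_gt0 sg0) // (divr_gt0 e0).
have eta1 : eta <= 1 by rewrite ge_min lexx.
have eta_sg : eta <= sg / 4 by rewrite !ge_min lexx !orbT.
have eta_e : 32 * q * S * eta <= e.
  by rewrite mulrC -ler_pdivlMr // !ge_min lexx !orbT.
exists eta; first by rewrite eta0 eta1.
exists (Num.min (t1 / (2 * sg)) (t0 / K)).
  by rewrite lt_min (divr_gt0 t00) // (divr_gt0 t10) // mulr_gt0.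
move=> x dl a b /andP[dl0]; rewrite lt_min => /andP[dl1 dl2] bK ba.
rewrite ltr_pdivlMr // in dl2; rewrite ltr_pdivlMr ?mulr_gt0 // in dl1.
have [a_sg|sg_a] := leP a (sg * dl).
  apply: (@le_trans _ _ (P (F x @^-1` small_gap (2 * sg * dl)))).
    apply: le_measure; rewrite ?inE.
    - exact: measurable_F_gap_band.
    - exact: measurable_F_small_gap.
    - move=> w; rewrite /gap_band /small_gap /= => /andP[_ h]; apply: le_trans h _.
      have := ler_wpM2r (ltW dl0) eta_sg; lra.
  apply: le_trans (hC x _ _) _; first by apply/andP; split; [have := mulr_gt0 sg0 dl0; lra|lra].
  have sg2 : 0 <= 2 * sg by lra.
  by rewrite lee_fin powRM ?(ltW dl0) // mulrA hsg.
have [ab|ab] := leP a b; last first.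
  rewrite (_ : F x @^-1` _ = set0) ?measure0 ?lee_fin ?mulr_ge0 ?powR_ge0 ?ltW //.
  by apply/seteqP; split => // w; rewrite /gap_band /= => /andP[h1 h2]; lra.
have sdl0 : 0 < sg * dl by rewrite mulr_gt0.
apply: le_trans (prob_band x hr t0c (lt_trans sdl0 sg_a) ab _) _; first lra.
rewrite lee_fin.
have ha : a `^ kappa <= dl `^ kappa * S.
  apply: le_trans (powR_le_sum kappa sdl0 (ltW sg_a) (le_trans ab bK)) _.
  by rewrite (powRM _ (ltW sg0) (ltW dl0)) (powRM _ (ltW K0) (ltW dl0)) -mulrDl mulrC.
have hb : b `^ kappa <= dl `^ kappa * S.
  apply: le_trans (powR_le_sum kappa sdl0 (le_trans (ltW sg_a) ab) bK) _.
  by rewrite (powRM _ (ltW sg0) (ltW dl0)) (powRM _ (ltW K0) (ltW dl0)) -mulrDl mulrC.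
have -> : dl `^ (kappa + 1) = dl `^ kappa * dl.
  rewrite powRD; last by apply/implyP => _; rewrite gt_eqF.
  by rewrite powRr1 ?ltW.
apply: (@le_trans _ _ (4 * q * (4 * eta * dl) * (2 * (dl `^ kappa * S)))).
  apply: ler_pM.
  - by rewrite !mulr_ge0 ?subr_ge0 // ltW.
  - by rewrite addr_ge0 ?powR_ge0.
  - by apply: ler_wpM2l => //; rewrite mulr_ge0 // ltW.
  - lra.
have -> : 4 * q * (4 * eta * dl) * (2 * (dl `^ kappa * S)) =
   32 * q * S * eta * (dl `^ kappa * dl) by ring.
by apply: ler_wpM2r => //; rewrite mulr_ge0 ?powR_ge0 // ltW.
Qed.

End Density.

(** * Probabilities of exceptional environments *)

Section EnvironmentEvents.
Context {R : realType} {d : measure_display} {T : measurableType d}.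
Variables (P : probability T R) (X : int + int -> T -> R) (c : R).
Hypothesis indep : mutually_independent P X.
Hypothesis mX : forall i, measurable_fun setT (X i).
Local Notation f := (fun w x => X (inl x) w).
Local Notation bounded w := (forall z, `|X (inl z) w| <= c).

Lemma oprob_unbounded : (forall x, P (X (inl x) @^-1` [set y | c <= `|y|]) = 0%E) ->
  oprob_le P [set w | exists x, ~ (`|X (inl x) w| <= c)] 0.
Proof.
move=> h; apply: oprob_le_countable => x.
apply: (@oprob_leW _ _ _ _ _ (X (inl x) @^-1` [set y | c <= `|y|]) _ 0) => //.
  by move=> w /= /negP; rewrite -ltNge => /ltW.
apply: oprob_le_measurable; last by rewrite h.
apply: measurable_preimage => //.
rewrite (_ : [set _ | _] = setT `&` (fun y : R => `|y|) @^-1` `[c, +oo[%classic).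
  by apply: normr_measurable.
by apply/seteqP; split => y /=; rewrite in_itv /= andbT; [split|case].
Qed.

Lemma oprob_three_small_gaps (x : int) (r p : R) :
  (forall x, (P (X (inl x) @^-1` small_gap c r) <= p%:E)%E) ->
  oprob_le P [set w | [/\ gap c (f w) x < r, gap c (f w) (x + 1) < r &
     gap c (f w) (x + 2) < r]] (p ^+ 3).
Proof.
move=> hp.
pose s := [seq (inl z : int + int, small_gap c r, p) | z <- [:: x; x + 1; x + 2]].
have -> : p ^+ 3 = \prod_(t <- s) t.2 by rewrite /s /= !big_cons big_nil /= mulr1 !exprS expr0 mulr1.
apply: (oprob_leW _ (lexx _) (oprob_le_rect indep mX (s := s) _ _)).
- move=> w [h0 h1 h2] t; rewrite !inE => /or3P[] /eqP -> /=; exact: ltW.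
- rewrite /s /= !inE !negb_or !andbT -andbA; apply/and3P; split; apply/eqP => -[] //; lia.
- move=> t /mapP[z _ ->] /=; split; [exact: measurable_small_gap|exact: hp].
Qed.

Lemma oprob_small_disc (x : int) (t p : R) :
  (forall x, (P (X (inl x) @^-1` small_gap c t) <= p%:E)%E) ->
  oprob_le P [set w | bounded w /\ discrepancy c (f w) x <= t] (p ^+ 2).
Proof.
move=> hp.
pose s := [seq (inl z : int + int, small_gap c t, p) | z <- [:: x; x + 1]].
have -> : p ^+ 2 = \prod_(t <- s) t.2 by rewrite /s /= !big_cons big_nil /= mulr1.
apply: (oprob_leW _ (lexx _) (oprob_le_rect indep mX (s := s) _ _)).
- move=> w [bw h] u; have [h0 h1] := gap_le_disc (f := f w) bw x.
  by rewrite !inE => /orP[] /eqP -> /=; apply: le_trans h.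
- by rewrite /s /= !inE !andbT; apply/eqP => -[]; lia.
- move=> u /mapP[z _ ->] /=; split; [exact: measurable_small_gap|exact: hp].
Qed.

(** The edges starting at even vertices are disjoint, hence independent, and such an edge has
    discrepancy at most [t] once its values are within [t / 2] of [c] and of [-c] respectively. *)
Lemma oprob_no_small_disc (J : nat) (t p : R) : 0 <= p ->
  (forall x, (p%:E <= P (X (inl x) @^-1` `[(c - t / 2)%R, (c - t / 2 / 2)%R]%classic))%E) ->
  (forall x, (p%:E <= P (X (inl x) @^-1` `[(t / 2 / 2 - c)%R, (t / 2 - c)%R]%classic))%E) ->
  (forall x y (A : set R), measurable A ->
     P (X (inl x) @^-1` A) = P (X (inl y) @^-1` A)) ->
  oprob_le P [set w | forall j, (j < J)%N -> ~ discrepancy c (f w) (2 * j)%N%:Z <= t]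
    (1 + J%:R * p ^+ 2)^-1.
Proof.
move=> p0 hA hA' idd.
set A := `[(c - t / 2)%R, (c - t / 2 / 2)%R]%classic in hA.
set A' := `[(t / 2 / 2 - c)%R, (t / 2 - c)%R]%classic in hA'.
have mA : measurable A by exact: measurable_itv.
have mA' : measurable A' by exact: measurable_itv.
have PA x : P (X (inl x) @^-1` A) \is a fin_num.
  by apply: fin_num_measure; exact: measurable_preimage.
have PA' x : P (X (inl x) @^-1` A') \is a fin_num.
  by apply: fin_num_measure; exact: measurable_preimage.
pose a := fine (P (X (inl 0) @^-1` A)); pose a' := fine (P (X (inl 0) @^-1` A')).
have ea x : P (X (inl x) @^-1` A) = a%:E by rewrite (idd x 0) // /a fineK.
have ea' x : P (X (inl x) @^-1` A') = a'%:E by rewrite (idd x 0) // /a' fineK.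
have pa : p <= a by rewrite -lee_fin -(ea 0).
have pa' : p <= a' by rewrite -lee_fin -(ea' 0).
have a1 : a <= 1 by rewrite -lee_fin -(ea 0) probability_le1 //; exact: measurable_preimage.
have a1' : a' <= 1 by rewrite -lee_fin -(ea' 0) probability_le1 //; exact: measurable_preimage.
pose u j := inl (2 * j)%N%:Z : int + int; pose v j := inl (2 * j + 1)%N%:Z : int + int.
have iu : injective u by move=> i j [] /eqP; rewrite eqn_pmul2l // => /eqP.
have iv : injective v by move=> i j [] /eqP; rewrite eqn_add2r eqn_pmul2l // => /eqP.
have uv i j : u i != v j by apply/eqP => -[]; lia.
have hp j : (P (X (u j) @^-1` A) * P (X (v j) @^-1` A') = (a * a')%:E)%E.
  by rewrite ea ea' EFinM.
have H := prob_no_pair indep mX iu iv uv mA mA' hp (m := J) (s := [::]) isT _ _.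
set N := [set w | forall j, (j < J)%N -> ~ (A (X (u j) w) /\ A' (X (v j) w))].
have PN : P N = ((1 - a * a') ^+ J)%:E.
  have := H; rewrite (_ : rect X [::] = setT); last by apply/seteqP; split.
  by rewrite setTI probability_setT mul1e; apply.
have mN : measurable N.
  rewrite (_ : N = \bigcap_(j in `I_J) ~` (X (u j) @^-1` A `&` X (v j) @^-1` A')).
    by apply: bigcap_measurableType => j _; apply: measurableC; apply: measurableI;
      exact: measurable_preimage.
  by apply/seteqP; split => w h j jJ; exact: (h j jJ).
exists N => //; split.
  move=> w h j jJ; rewrite /A /A' /= !in_itv /= => -[/andP[h1 h2] /andP[h3 h4]].
  apply: (h j jJ); rewrite /discrepancy.
  have -> : (2 * j)%N%:Z + 1 = (2 * j + 1)%N%:Z by rewrite PoszD.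
  have := ler_norm (- (X (inl (2 * j + 1)%N%:Z) w - X (inl (2 * j)%N%:Z) w)).
  by rewrite normrN; rewrite /u /v in h1 h2 h3 h4; lra.
rewrite PN lee_fin.
have aa : p ^+ 2 <= a * a' by rewrite expr2; apply: ler_pM.
have aa1 : a * a' <= 1 by rewrite -[1]mulr1; apply: ler_pM => //; apply: le_trans p0 _.
have p20 : 0 <= p ^+ 2 by exact: exprn_ge0.
have aa01 : 0 <= a * a' <= 1 by rewrite aa1 andbT; exact: le_trans aa.
have Jp : 0 <= J%:R * p ^+ 2 by exact: mulr_ge0.
rewrite -[leRHS]mul1r ler_pdivlMr; last by lra.
apply: le_trans (expr_le_inv J aa01); apply: ler_wpM2l; first by apply: exprn_ge0; lra.
by rewrite lerD2l ler_wpM2l.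
Qed.

Lemma sum_triple (s : seq nat) (a b e : nat -> R) (z : R) :
  \sum_(i <- s) \sum_(j <- s) \sum_(l <- s) a i * (b j * (e l * z)) =
  (\sum_(i <- s) a i) * ((\sum_(j <- s) b j) * ((\sum_(l <- s) e l) * z)).
Proof.
rewrite mulr_suml; apply: eq_bigr => i _.
rewrite [in RHS]mulr_suml mulr_sumr; apply: eq_bigr => j _.
by rewrite [in RHS]mulr_suml !mulr_sumr.
Qed.

Definition gap_cell (h : R) (i : nat) : set R :=
  [set y | c - `|y| \in `[i%:R * h, i.+1%:R * h[].

Lemma measurable_gap_cell h i : measurable (gap_cell h i).
Proof. exact: measurable_gap_itv. Qed.

Lemma sum_gap_cells x h p N : 0 <= h ->
  (P (X (inl x) @^-1` small_gap c (N%:R * h)) <= p%:E)%E ->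
  \sum_(i <- iota 0 N) fine (P (X (inl x) @^-1` gap_cell h i)) <= p.
Proof.
move=> h0.
pose U n : set R := [set y | c - `|y| \in `[0, n%:R * h[].
have mU n : measurable (X (inl x) @^-1` U n).
  by apply: measurable_preimage => //; exact: measurable_gap_itv.
have mC n : measurable (X (inl x) @^-1` gap_cell h n).
  by apply: measurable_preimage => //; exact: measurable_gap_cell.
have sumU : (\sum_(i <- iota 0 N) fine (P (X (inl x) @^-1` gap_cell h i)))%:E =
    P (X (inl x) @^-1` U N).
  elim: N => [|n IH].
    rewrite big_nil (_ : _ @^-1` _ = set0) ?measure0 //; apply/seteqP; split => // w.
    by rewrite /U /= mul0r in_itv /= => /andP[h1 h2]; lra.
  rewrite -addn1 iotaD big_cat /= big_cons big_nil addr0 EFinD IH add0n fineK; last first.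
    by apply: fin_num_measure.
  rewrite -measureU //; last first.
    apply/seteqP; split => // w [] /=; rewrite /U /gap_cell /= !in_itv /=.
    by move=> /andP[_ h1] /andP[h2 _]; move: (lt_le_trans h1 h2); rewrite ltxx.
  congr (P _); apply/seteqP; split => w; rewrite /U /gap_cell /= !in_itv /=.
    case=> /andP[h1 h2]; apply/andP; split => //; rewrite ?addn1 //.
      by apply: lt_le_trans h2 _; apply: ler_wpM2r => //; rewrite ler_nat.
    by apply: le_trans h1; exact: mulr_ge0.
  move=> /andP[h1 h2]; case: (ltP (c - `|X (inl x) w|) (n%:R * h)) => h3.
    by left; apply/andP; split.
  by right; apply/andP; split => //; rewrite -addn1.
move=> hp; rewrite -lee_fin sumU; apply: le_trans hp; apply: le_measure; rewrite ?inE //.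
  by apply: measurable_preimage => //; exact: measurable_small_gap.
by move=> w; rewrite /U /small_gap /= in_itv /= => /andP[_ /ltW].
Qed.

(* Discretising three of the four gaps involved in d(x) and d(y) confines the fourth
   one to a short interval. *)
Lemma oprob_near_tie (x y : int) (N : nat) (h p e : R) : 0 < h -> N%:R * h <= c ->
  2 <= `|x - y| -> 0 <= e ->
  (forall x, (P (X (inl x) @^-1` small_gap c (N%:R * h)) <= p%:E)%E) ->
  (forall x a b, b <= (2 * N%:R + 3) * h -> b - a <= 4 * h ->
     (P (X (inl x) @^-1` gap_band c a b) <= e%:E)%E) ->
  oprob_le P [set w | [/\ bounded w, discrepancy c (f w) y < N%:R * h,
     discrepancy c (f w) x <= discrepancy c (f w) y &
     discrepancy c (f w) y < discrepancy c (f w) x + h]] (p ^+ 3 * e).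
Proof.
move=> h0 Nc xy e0 hp he.
pose a z i := fine (P (X (inl z) @^-1` gap_cell h i)).
have a0 z i : 0 <= a z i by rewrite /a fine_ge0.
have suma z : \sum_(i <- iota 0 N) a z i <= p.
  by apply: (sum_gap_cells (ltW h0)); exact: hp.
have sa0 z : 0 <= \sum_(i <- iota 0 N) a z i by apply: sumr_ge0.
(* The gap at [y + 1] is d(y) minus the gap at [y]. The cells locate the gap sum at [x] within [2 h]
   and the gap at [y] within [h], and d(y) - d(x) lies in [0, h): total width [4 h]. *)
pose lo (i j l : nat) : R := (i%:R + j%:R - l%:R - 1) * h.
pose S i j l := [set w | [/\ gap_cell h i (X (inl x) w), gap_cell h j (X (inl (x + 1)) w),
  gap_cell h l (X (inl y) w) & gap_band c (lo i j l) (lo i j l + 4 * h) (X (inl (y + 1)) w)]].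
have HS i j l : i \in iota 0 N -> j \in iota 0 N -> l \in iota 0 N ->
    oprob_le P (S i j l) (a x i * (a (x + 1) j * (a y l * e))).
  rewrite !mem_iota /= !add0n => iN jN lN.
  pose s := [:: (inl x : int + int, gap_cell h i, a x i);
                (inl (x + 1), gap_cell h j, a (x + 1) j);
                (inl y, gap_cell h l, a y l);
                (inl (y + 1), gap_band c (lo i j l) (lo i j l + 4 * h), e)].
  have -> : a x i * (a (x + 1) j * (a y l * e)) = \prod_(t <- s) t.2.
    by rewrite /s /= !big_cons big_nil /= mulr1.
  apply: (oprob_leW _ (lexx _) (oprob_le_rect indep mX (s := s) _ _)).
  - by move=> w [h1 h2 h3 h4] t; rewrite !inE => /or4P[] /eqP -> /=.
  (* Distance at least 2 makes the four vertices distinct, as the product rule requires. *)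
  - have ne1 : x <> x + 1 by lia.
    have ne2 : x <> y by lia.
    have ne3 : x <> y + 1 by lia.
    have ne4 : x + 1 <> y by lia.
    have ne5 : x + 1 <> y + 1 by lia.
    have ne6 : y <> y + 1 by lia.
    rewrite /s /= !inE !negb_or !andbT -!andbA.
    by apply/and5P; split; [..|apply/andP; split]; apply/eqP => -[].
  - have cell z k : measurable (gap_cell h k) /\
        (P (X (inl z) @^-1` gap_cell h k) <= (a z k)%:E)%E.
      split; first exact: measurable_gap_cell.
      rewrite /a fineK //; apply: fin_num_measure; apply: measurable_preimage => //.
      exact: measurable_gap_cell.
    move=> t; rewrite !inE => /or4P[] /eqP -> /=; try exact: cell.
    split; first exact: measurable_gap_band.
    apply: he; last by rewrite addrAC subrr add0r.
    have iR : i%:R <= N%:R :> R by rewrite ler_nat ltnW.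
    have jR : j%:R <= N%:R :> R by rewrite ler_nat ltnW.
    have lR : 0 <= l%:R :> R by [].
    rewrite /lo -mulrDl; apply: ler_wpM2r; [exact: ltW|lra].
apply: (oprob_leW (S' := [set w | exists2 i, i \in iota 0 N & exists2 j, j \in iota 0 N &
    exists2 l, l \in iota 0 N & S i j l w]) _ _ _); last first.
- apply: oprob_le_bigU => i iN; apply: oprob_le_bigU => j jN; apply: oprob_le_bigU => l lN.
  exact: HS.
- rewrite sum_triple !exprS expr0 mulr1 -!mulrA.
  by apply: ler_pM; rewrite ?mulr_ge0 //; apply: ler_pM; rewrite ?mulr_ge0 //; exact: ler_pM.
move=> w [bw yN xley yx].
have yc : discrepancy c (f w) y < c by exact: lt_le_trans Nc.
have xc : discrepancy c (f w) x < c by exact: le_lt_trans yc.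
have [g1 g2] := gap_le_disc (f := f w) bw x; have [g3 g4] := gap_le_disc (f := f w) bw y.
have dx := disc_small (f := f w) bw xc; have dy := disc_small (f := f w) bw yc.
have cellP z : gap c (f w) z < N%:R * h ->
    exists2 i, i \in iota 0 N & gap_cell h i (X (inl z) w).
  move=> zN; have z0 := gap_ge0 (f := f w) bw z.
  have zh : 0 <= gap c (f w) z / h by rewrite divr_ge0 // ltW.
  have /andP[t1 t2] := truncn_itv zh; rewrite ler_pdivlMr // in t1; rewrite ltr_pdivrMr // in t2.
  exists (Num.truncn (gap c (f w) z / h)); last by rewrite /gap_cell /= in_itv /= t1 t2.
  by rewrite mem_iota /= add0n truncn_lt_nat // ltr_pdivrMr.
have [i iN hi] := cellP x ltac:(lra); have [j jN hj] := cellP (x + 1) ltac:(lra).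
have [l lN hl] := cellP y ltac:(lra).
exists i => //; exists j => //; exists l => //; split => //.
move: hi hj hl; rewrite /gap_cell /gap_band /= !in_itv /= -!natr1 !mulrDl !mul1r.
rewrite -/(gap c (f w) x) -/(gap c (f w) (x + 1)) -/(gap c (f w) y) -/(gap c (f w) (y + 1)).
move=> /andP[i1 i2] /andP[j1 j2] /andP[l1 l2]; rewrite /lo !mulrBl !mulrDl mul1r.
by apply/andP; split; lra.
Qed.

End EnvironmentEvents.

(** * Scaling limit of the minimizer *)

(** [K] adds the walking cost [2 c] and the staying cost [K1], in units of [n dl]. By [argmin_cost]
    the truncated discrepancy is at most 4 (K + K) dl, the second [K] paying for the incomplete
    window; the truncation level [9 K dl] is taken just above the resulting [8 K dl]. *)
Lemma environment_conclusion (R : realType) (c : R) (b f : int -> R) (n k w M : nat)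
    (g : nat -> int) (l : int) (dl K1 k1 r eta : R) :
  let K := 2 * c + K1 in
  0 < c -> (forall x, `|f x| <= c) -> (forall i, b i = 1 \/ b i = -1) ->
  minimizing_walk b f n g -> is_argmin_discrepancy c f n g l ->
  0 < dl <= 1 -> 0 <= K1 -> 0 < k1 <= 9 * K -> r <= c -> (2 <= k)%N -> (0 < w)%N ->
  (exists2 j : nat, (2 * j)%N%:R <= n%:R * dl & discrepancy c f (2 * j)%N%:Z <= K1 * dl) ->
  K * (n%:R * dl) < \sum_(1 <= v < M.+1) gap c f v%:Z ->
  K * (n%:R * dl) < \sum_(1 <= v < M.+1) gap c f (- v%:Z) ->
  (forall x : int, `|x| <= M%:Z + 2 ->
    ~ [/\ gap c f x < r, gap c f (x + 1) < r & gap c f (x + 2) < r]) ->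
  (forall u, (u <= n)%N -> balanced b k w u) ->
  (forall x : int, `|x| <= M%:Z -> k1 * dl < discrepancy c f x) ->
  (forall x : int, `|x%:~R| < k1 * (n%:R * dl) -> 9 * K * dl < discrepancy c f x) ->
  0 <= eta -> 2 * (9 * K * dl) <= eta * (k%:R - 1) ->
  (forall x y : int, `|x| <= M%:Z -> `|y| <= M%:Z -> 2 <= `|x - y| ->
     discrepancy c f x <= 9 * K * dl -> discrepancy c f x <= discrepancy c f y ->
     discrepancy c f x + eta <= discrepancy c f y) ->
  (k * w).+1%:R * (9 * K * dl) < r ->
  9 * K * (k * w)%:R <= n%:R * (k1 / 8) -> 9 * K * (k * w)%:R <= n%:R * K ->
  [/\ stays_after_hit n g l,
      k1 * (n%:R * dl) <= `|l%:~R : R| /\ `|l| < M%:Z,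
      k1 * dl <= discrepancy c f l <= 8 * K * dl &
      k1 / 8 * (n%:R * dl) <= c * n%:R + action b f n g <= K * (n%:R * dl)].
Proof.
move=> K c0 hf hb gm lam /andP[dl0 dl1] K10 /andP[k10 k1K] rc k2 w0 [j jL dj] S1 S2 no3 bal
  H6 H7 eta0 hk sep hr hW1 hW2.
have K0 : 0 < K by rewrite /K; lra.
have n0 : 0 <= n%:R :> R by [].
have D00 : 0 <= 9 * K * dl by rewrite !mulr_ge0 // ltW.
have cost_le : cost c b f g 1 n.+1 <= K * (n%:R * dl).
  have jn : (2 * j <= n)%N.
    rewrite -(ler_nat R); apply: le_trans jL _; rewrite -[leRHS]mulr1.
    exact: ler_wpM2l.
  apply: le_trans (minimal_cost_le_straight hf hb gm jn) _; rewrite /K mulrDl.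
  have c20 : 0 <= 2 * c by lra.
  by have := ler_wpM2l c20 jL; have := ler_wpM2l n0 dj; lra.
have [g0 lz _] := gm.
have conf := walk_confined hf hb g0 lz cost_le S1 S2.
have low := argmin_cost hf hb k2 w0 rc D00 hr no3 bal gm conf lam.
have lM : `|l| < M%:Z by case: (lam) => -[i ii <-] _; exact: conf.
have dl_low : k1 * dl < discrepancy c f l by apply: H6; exact: ltW.
have hW2' := ler_wpM2r (ltW dl0) hW2; have hW1' := ler_wpM2r (ltW dl0) hW1.
have dl_up : discrepancy c f l <= 8 * K * dl.
  rewrite leNgt; apply/negP => h.
  have nd : 0 < n%:R * dl.
    rewrite mulr_gt0 // ltr0n lt0n; apply/eqP => n0'.
    by move: hW2; rewrite n0' mul0r leNgt => /negP; apply; rewrite !mulr_gt0 // ltr0n muln_gt0 w0 (ltnW k2).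
  have : 8 * K * dl < Num.min (discrepancy c f l) (9 * K * dl).
    by rewrite lt_min h /=; have := mulr_gt0 K0 dl0; lra.
  move=> h'; have n1 : 0 < n%:R :> R by move: nd; rewrite pmulr_lgt0.
  have : n%:R * (8 * K * dl) < n%:R * Num.min (discrepancy c f l) (9 * K * dl).
    by rewrite ltr_pM2l.
  by lra.
split => //.
- apply: (localised hf hb k2 w0 rc D00 hr no3 bal gm conf lam eta0 _ hk sep).
  by have := mulr_gt0 K0 dl0; lra.
- split => //; rewrite leNgt; apply/negP => /H7.
  by have := mulr_gt0 K0 dl0; lra.
- by rewrite (ltW dl_low).
rewrite -cost_action cost_le andbT.
(* A quarter of [k1 n dl], less the eighth that [hW1] allows for the incomplete window. *)
have : k1 * dl <= Num.min (discrepancy c f l) (9 * K * dl).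
  by rewrite le_min (ltW dl_low) /=; apply: ler_wpM2r => //; exact: ltW.
by move/(ler_wpM2l n0) => h; lra.
Qed.

Lemma sum_ge_half (R : realType) (h : nat -> R) (s : seq nat) (g0 : R) :
  0 <= g0 -> (forall v, 0 <= h v) ->
  ~ (size s <= 2 * count (fun v => `[< (h v <= g0)%R >]) s)%N ->
  (size s)%:R / 2 * g0 <= \sum_(v <- s) h v.
Proof.
move=> g00 h0 /negP; rewrite -ltnNge => hs.
have sub : \sum_(v <- s) (if `[< h v <= g0 >] then 0 else g0) <= \sum_(v <- s) h v.
  apply: ler_sum => v _; case: asboolP => // /negP; rewrite -ltNge; exact: ltW.
apply: le_trans sub.
have -> : \sum_(v <- s) (if `[< h v <= g0 >] then 0 else g0) =
    (size s - count (fun v => `[< (h v <= g0)%R >]) s)%N%:R * g0.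
  rewrite -(count_predC (fun v => `[< h v <= g0 >])) addKn -sum1_count natr_sum mulr_suml [RHS]big_mkcond /=.
  by apply: eq_bigr => v _; case: `[< _ >]; rewrite ?mul1r.
apply: ler_wpM2r => //; rewrite natrB ?count_size //.
by move: hs; rewrite -(ltr_nat R) natrM; lra.
Qed.

Definition int_range (M : nat) : seq int :=
  [seq k%:Z | k <- iota 0 M.+1] ++ [seq - k%:Z | k <- iota 0 M.+1].

Lemma mem_int_range M (x : int) : `|x| <= M%:Z -> x \in int_range M.
Proof.
move=> xM; rewrite mem_cat; apply/orP; case: (lerP 0 x) => x0; [left|right]; apply/mapP;
  exists `|x|%N; rewrite ?mem_iota /=; lia.
Qed.

Lemma size_int_range M : size (int_range M) = (2 * M.+1)%N.
Proof. by rewrite size_cat !size_map !size_iota addnn mul2n. Qed.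

(** * Growth of powers and logarithms *)

Section Asymptotics.
Variable R : realType.

Lemma near_powRN (a x : R) : 0 < a -> 0 < x ->
  \forall n \near \oo, (n%:R : R) `^ (- a) < x.
Proof.
move=> a0 x0; exists (Num.truncn (x^-1 `^ a^-1)).+1 => // n /= hn.
have z0 : 0 <= x^-1 `^ a^-1 by exact: powR_ge0.
have hz : x^-1 `^ a^-1 < n%:R.
  have /andP[_ h] := truncn_itv z0; apply: lt_le_trans h _; by rewrite ler_nat.
have n0 : 0 < n%:R :> R by exact: le_lt_trans hz.
rewrite powRN -[x]invrK ltf_pV2 ?posrE ?powR_gt0 ?invr_gt0 //.
have : (x^-1 `^ a^-1) `^ a < n%:R `^ a by apply: gt0_ltr_powR; rewrite ?nnegrE // ltW.
by rewrite -powRrM mulVf ?gt_eqF // powRr1 // invr_ge0 ltW.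
Qed.

Lemma ln_le_powR (a x : R) : 0 < a -> 0 < x -> ln x <= a^-1 * x `^ a.
Proof.
move=> a0 x0; rewrite mulrC ler_pdivlMr // mulrC -ln_powR.
by apply/ltW/ln_sublinear/powR_gt0.
Qed.

Lemma near_log_powRN (a A x : R) : 0 < a -> 0 <= A -> 0 < x ->
  \forall n \near \oo, A * (ln n%:R + 1) * (n%:R : R) `^ (- a) < x.
Proof.
move=> a0 A0 x0.
have a20 : 0 < a / 2 by rewrite divr_gt0.
pose B := A * ((a / 2)^-1 + 1) + 1.
have B0 : 0 < B by rewrite ltr_wpDl // mulr_ge0 // addr_ge0 // invr_ge0 ltW.
have := near_powRN a20 (divr_gt0 x0 B0).
move=> [N _ hN]; exists N.+1 => // n /= Nn.
have n1 : 1 <= n%:R :> R by rewrite ler1n (leq_ltn_trans _ Nn).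
have n0 : 0 < n%:R :> R by lra.
have := hN n (ltnW Nn); rewrite /= ltr_pdivlMr // => h; apply: le_lt_trans h.
(* Half of the power absorbs the logarithm, the other half tends to 0. *)
have -> : - a = - (a / 2) + - (a / 2) by field.
rewrite powRD; last by apply/implyP => _; rewrite gt_eqF.
rewrite mulrA [leRHS]mulrC; apply: ler_wpM2r; first exact: powR_ge0.
have p0 : 0 <= n%:R `^ (- (a / 2)) :> R by exact: powR_ge0.
have p1 : n%:R `^ (- (a / 2)) <= 1 :> R.
  rewrite powRN invf_le1 ?powR_gt0 // -[leLHS](powRr0 n%:R).
  by apply: ler_powR => //; exact: ltW.
have h1 := ler_wpM2r p0 (ln_le_powR a20 n0).
have pp : n%:R `^ (a / 2) * n%:R `^ (- (a / 2)) = 1 :> R.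
  by rewrite powRN mulfV // gt_eqF // powR_gt0.
rewrite -mulrA in h1; rewrite pp mulr1 in h1.
have : A * ((ln n%:R + 1) * n%:R `^ (- (a / 2))) <= A * ((a / 2)^-1 + 1).
  by apply: ler_wpM2l => //; rewrite mulrDl mul1r lerD.
by rewrite /B mulrA; lra.
Qed.

Lemma near_nat_ge (x : R) : \forall n \near \oo, x <= n%:R.
Proof.
exists (Num.truncn `|x|).+1 => // n /= hn; apply: le_trans (ler_norm x) _.
have /andP[_ /ltW h] := truncn_itv (normr_ge0 x).
by apply: le_trans h _; rewrite ler_nat.
Qed.

Lemma exp_ge_square (lam : R) (n w : nat) : 1 < lam -> (0 < n)%N ->
  2 * ln n%:R / ln lam <= w%:R -> n%:R ^+ 2 <= lam ^+ w.
Proof.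
move=> l1 n0 hw; have l0 : 0 < lam by lra.
have n0' : 0 < n%:R :> R by rewrite ltr0n.
rewrite -ler_ln ?posrE ?exprn_gt0 // (lnXn 2 n0') (lnXn w l0).
rewrite -[ln n%:R *+ 2]mulr_natl -[ln lam *+ w]mulr_natl.
by rewrite -ler_pdivrMr // ln_gt0.
Qed.

End Asymptotics.

Lemma powR_exprn (R : realType) (x b : R) (m : nat) : 0 <= x ->
  (x ^+ m) `^ b = (x `^ b) ^+ m.
Proof.
move=> x0; elim: m => [|m IH]; first by rewrite !expr0 powR1.
by rewrite !exprS powRM ?exprn_ge0 // IH.
Qed.

Lemma truncn_half (R : archiRealFieldType) (x : R) : 4 <= x ->
  exists2 J : nat, x / 4 <= J%:R & 2 * J%:R <= x.
Proof.
move=> x4; have x2 : 0 <= x / 2 by lra.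
have /andP[J1 J2] := truncn_itv x2; exists (Num.truncn (x / 2)); last by lra.
by move: J2; rewrite (mulrSr 1 (Num.truncn _)); lra.
Qed.

Lemma powR_root (R : realType) (y b : R) : 0 < y -> 0 < b ->
  exists2 x, 0 < x & x `^ b = y.
Proof.
move=> y0 b0; exists (y `^ b^-1); first exact: powR_gt0.
by rewrite -powRrM mulVf ?gt_eqF // powRr1 // ltW.
Qed.

(** This [z0] makes [L / 4 * p^2] equal to [e^(-2)], which is at least [1 / e]. *)
Lemma small_inverse (R : realFieldType) (e C z0 J p D L : R) : 0 < e <= 1 -> 0 < C ->
  z0 = 2 / (C * e) -> L * D ^+ 2 = 1 -> L / 4 <= J -> p = C * z0 * D ->
  (1 + J * p ^+ 2)^-1 <= e.
Proof.
move=> /andP[e0 e1] C0 ez rel LJ ep.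
have h1 : L / 4 * p ^+ 2 <= J * p ^+ 2 by apply: ler_wpM2r => //; exact: sqr_ge0.
have h2 : L / 4 * p ^+ 2 = e^-1 ^+ 2.
  have -> : L / 4 * p ^+ 2 = (C * z0) ^+ 2 / 4 * (L * D ^+ 2) by rewrite ep; field.
  by rewrite rel mulr1 ez; field; rewrite !gt_eqF.
have e11 : 1 <= e^-1 by rewrite invf_ge1.
have e00 : 0 <= e^-1 by rewrite invr_ge0 ltW.
have h4 : e^-1 <= e^-1 ^+ 2 by rewrite expr2 -[leLHS]mulr1; apply: ler_wpM2l.
by rewrite invf_ple ?posrE //; lra.
Qed.

(** * Exceptional environments at scale n *)

Section ScaledEvents.
Context {R : realType} {d : measure_display} {T : measurableType d}.
Variables (P : probability T R) (X : int + int -> T -> R) (c beta z : R).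
Hypothesis indep : mutually_independent P X.
Hypothesis mX : forall i, measurable_fun setT (X i).
Hypothesis beta_gt0 : 0 < beta.
Hypothesis z01 : 0 < z < 1.
Hypothesis z_beta : z + (z - 1) * (2 * beta) = 0.
Variables (C0 t0 : R).
Hypothesis C0_gt0 : 0 < C0.
Hypothesis t0_lt : 0 < t0 < c.
Hypothesis cdf : forall x t, 0 < t < t0 ->
  (P (X (inl x) @^-1` small_gap c t) <= (C0 * t `^ beta)%:E)%E.
Local Notation f := (fun w x => X (inl x) w).
Local Notation bounded w := (forall z, `|X (inl z) w| <= c).
Local Notation disc w := (discrepancy c (f w)).

Definition gap_scale (n : nat) : R := n%:R `^ (z - 1).
Local Notation dl := gap_scale.
Local Notation L n := (n%:R * dl n).
(* The fourth root of the gap scale: its cube is the threshold below which a gap is small. *)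
Definition quarter_scale (n : nat) : R := n%:R `^ (- ((1 - z) / 4)).
Local Notation s := quarter_scale.

Lemma gap_scale_quarter n : dl n = s n ^+ 4.
Proof.
rewrite /gap_scale /quarter_scale -powR_mulrn ?powR_ge0 // -powRrM; congr (_ `^ _).
by field.
Qed.

Lemma range_scaleE n : (0 < n)%N -> L n = n%:R `^ z.
Proof.
move=> n0; rewrite -{1}[n%:R]powRr1 // -powRD; last first.
  by apply/implyP => _; rewrite pnatr_eq0 -lt0n.
by congr (_ `^ _); ring.
Qed.

Lemma scale_gt0 n : (0 < n)%N -> [/\ 0 < dl n, 0 < s n & 0 < L n].
Proof. by move=> n0; rewrite mulr_gt0 ?powR_gt0 ?ltr0n. Qed.

Lemma scale_relation n : (0 < n)%N -> L n * (dl n `^ beta) ^+ 2 = 1.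
Proof.
move=> n0; have ne : n%:R != 0 :> R by rewrite pnatr_eq0 -lt0n.
rewrite range_scaleE // -powR_mulrn ?powR_ge0 // -!powRrM -powRD; last by rewrite ne implybT.
by rewrite [X in _ `^ X](_ : _ = 0) ?powRr0 // -[RHS]z_beta; ring.
Qed.

Lemma near_gt0 : \forall n \near \oo, (0 < n)%N.
Proof. by exists 1%N. Qed.

Lemma near_gap_scale (x : R) : 0 < x -> \forall n \near \oo, dl n < x.
Proof.
move=> x0; have z1 : 0 < 1 - z by have := z01; lra.
by have := near_powRN z1 x0; apply: filterS => n; rewrite opprB.
Qed.

Lemma near_quarter_scale (x : R) : 0 < x -> \forall n \near \oo, s n < x.
Proof.
move=> x0; have z1 : 0 < (1 - z) / 4 by have := z01; lra.
exact: near_powRN.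
Qed.

Lemma near_range_scale (x : R) : \forall n \near \oo, x <= L n.
Proof.
have z0 : 0 < z by case/andP: z01.
have y0 : 0 < (`|x| + 1)^-1 by rewrite invr_gt0 ltr_wpDl.
have := near_powRN z0 y0; move/(filterI near_gt0); apply: filterS => n [n0].
rewrite range_scaleE // powRN ltf_pV2 ?posrE ?powR_gt0 ?ltr0n // ?ltr_wpDl // => h.
by have := ler_norm x; lra.
Qed.

Lemma near_small_disc_exists (C1 t1 : R) : 0 < C1 -> 0 < t1 ->
  (forall x t, 0 < t < t1 ->
    ((C1 * t `^ beta)%:E <= P (X (inl x) @^-1` `[(c - t)%R, (c - t / 2)%R]%classic))%E /\
    ((C1 * t `^ beta)%:E <= P (X (inl x) @^-1` `[(t / 2 - c)%R, (t - c)%R]%classic))%E) ->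
  (forall x y (A : set R), measurable A ->
     P (X (inl x) @^-1` A) = P (X (inl y) @^-1` A)) ->
  forall e, 0 < e <= 1 -> exists2 K1, 0 < K1 & \forall n \near \oo,
    oprob_le P [set w | ~ exists2 j : nat, (2 * j)%N%:R <= L n &
      disc w (2 * j)%N%:Z <= K1 * dl n] e.
Proof.
move=> C10 t10 low idd e /andP[e0 e1].
have b0 := beta_gt0.
(* The value required by [small_inverse]. [K1] is twice the root because each endpoint is allowed
   half of the discrepancy. *)
have z00 : 0 < 2 / (C1 * e) by rewrite divr_gt0 // mulr_gt0.
have [y0 y00 ey] := powR_root z00 b0.
exists (2 * y0); first by rewrite mulr_gt0.
near=> n.
have n0 : (0 < n)%N by near: n; exact: near_gt0.
have L4 : 4 <= L n by near: n; exact: near_range_scale.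
have dlt : dl n < t1 / y0 by near: n; apply: near_gap_scale; exact: divr_gt0.
have [dl0 _ L0] := scale_gt0 n0.
rewrite ltr_pdivlMr // in dlt.
have t2 : 2 * y0 * dl n / 2 = y0 * dl n by field.
have tt : 0 < 2 * y0 * dl n / 2 < t1 by rewrite t2 mulr_gt0 //= mulrC.
have [J JL J2] := truncn_half L4.
have p0 : 0 <= C1 * (2 * y0 * dl n / 2) `^ beta by rewrite mulr_ge0 ?powR_ge0 ?(ltW C10).
have ep : C1 * (2 * y0 * dl n / 2) `^ beta = C1 * (2 / (C1 * e)) * dl n `^ beta.
  by rewrite t2 powRM ?(ltW y00) ?(ltW dl0) // ey mulrA.
have := @oprob_no_small_disc _ _ _ P X c indep mX J (2 * y0 * dl n) _ p0
  (fun x => (low x _ tt).1) (fun x => (low x _ tt).2) idd.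
apply: oprob_leW.
  move=> w h j jJ dj; apply: h; exists j => //.
  apply: le_trans J2; rewrite natrM; apply: ler_wpM2l => //.
  by rewrite ler_nat ltnW.
apply: (small_inverse (z0 := 2 / (C1 * e)) _ _ _ (scale_relation n0) JL ep) => //.
by rewrite e0 e1.
Unshelve. all: by end_near. Qed.

(** A gap is at most [g0] with probability at most [e / 4], so by [oprob_le_half] more than half of
    the [M] gaps on each side exceed [g0], up to probability [e / 2] per side. [M] is then chosen
    with [M g0 / 2 > K L]. *)
Lemma near_gaps_sum (K e : R) : 0 < K -> 0 < e -> exists2 k2, 0 < k2 &
  \forall n \near \oo, exists M : nat, [/\ (0 < M)%N, M%:R <= k2 * L n &
    oprob_le P [set w | bounded w /\
      ~ (K * L n < \sum_(1 <= v < M.+1) gap c (f w) v%:Z /\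
         K * L n < \sum_(1 <= v < M.+1) gap c (f w) (- v%:Z))] e].
Proof.
move=> K0 e0; have b0 := beta_gt0; have C00 := C0_gt0; have /andP[t00 t0c] := t0_lt.
have eC : 0 < e / (4 * C0) by rewrite divr_gt0 // mulr_gt0.
have [y1 y10 ey] := powR_root eC b0.
have [g0 /andP[g00 g0t0] g0y] : exists2 g0, 0 < g0 < t0 & g0 <= y1.
  exists (Num.min (t0 / 2) y1); last by rewrite ge_min lexx orbT.
  by rewrite lt_min divr_gt0 //= y10 gt_min; apply/orP; left; lra.
have g0t : 0 < g0 < t0 by rewrite g00.
have hg0 : C0 * g0 `^ beta <= e / 4.
  have : g0 `^ beta <= e / (4 * C0).
    by rewrite -ey; apply: ge0_ler_powR; rewrite ?nnegrE ?(ltW b0) ?(ltW g00) ?(ltW y10).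
  by move/(ler_wpM2l (ltW C00)) => h; apply: le_trans h _; rewrite invfM !mulrA mulrC !mulrA mulVf ?mul1r ?gt_eqF.
have kk : 0 < 2 * K / g0 by rewrite divr_gt0 // mulr_gt0.
exists (2 * K / g0 + 1); first by lra.
near=> n.
have n0 : (0 < n)%N by near: n; exact: near_gt0.
have L1 : 1 <= L n by near: n; exact: near_range_scale.
have [dl0 _ L0] := scale_gt0 n0.
have kL : 0 <= 2 * K / g0 * L n by rewrite mulr_ge0 // ltW.
exists (Num.truncn (2 * K / g0 * L n)).+1; have /andP[M1 M2] := truncn_itv kL.
set M := (Num.truncn _).+1 in M2 *; split => //.
  by rewrite /M (mulrSr 1 (Num.truncn _)); lra.
have MK : K * L n < M%:R / 2 * g0.
  have eg : 2 * K / g0 * L n * g0 = 2 * K * L n by field; rewrite gt_eqF.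
  by have := M2; rewrite -(ltr_pM2r g00) eg => h; lra.
have half (F : nat -> int) : oprob_le P [set w | (size (iota 1 M) <=
    2 * count (fun v => `[< (X (inl (F v)) @^-1` small_gap c g0) w >]) (iota 1 M))%N]
    (2 * (e / 4)).
  apply: oprob_le_half => [v|v _|]; last by rewrite size_iota.
    by apply: measurable_preimage => //; exact: measurable_small_gap.
  by apply: le_trans (cdf _ g0t) _; rewrite lee_fin.
have := oprob_leU (half (fun v => v%:Z)) (half (fun v => - v%:Z)).
apply: oprob_leW; last lra.
move=> w [bw h]; apply: contrapT => /not_orP[h1 h2]; apply: h.
have I1 : index_iota 1 M.+1 = iota 1 M by rewrite /index_iota subn1.
rewrite I1; split; apply: lt_le_trans MK _;
  rewrite -{1}(size_iota 1 M); apply: (sum_ge_half (ltW g00)) => //;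
  by move=> v; exact: gap_ge0.
Unshelve. all: by end_near. Qed.

(** With [s^4 = dl], three gaps below [s^3] cost [s^(9 beta)] in probability; against
    [L s^(8 beta) = 1] the union bound leaves [s^beta], which tends to 0. *)
Lemma near_three_small_gaps (A e : R) : 0 <= A -> 0 < e -> \forall n \near \oo,
  forall M : nat, M%:R <= A * L n ->
  oprob_le P [set w | exists2 x : int, `|x| <= M%:Z + 2 &
    [/\ gap c (f w) x < s n ^+ 3, gap c (f w) (x + 1) < s n ^+ 3 &
        gap c (f w) (x + 2) < s n ^+ 3]] e.
Proof.
move=> A0 e0; have b0 := beta_gt0; have C00 := C0_gt0; have /andP[t00 t0c] := t0_lt.
have z1 : 0 < (1 - z) / 4 by have := z01; lra.
have AC : 0 < (2 * A + 6) * C0 ^+ 3 by rewrite mulr_gt0 ?exprn_gt0 //; lra.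
near=> n => M ML.
have n0 : (0 < n)%N by near: n; exact: near_gt0.
have L1 : 1 <= L n by near: n; exact: near_range_scale.
have s1 : s n < Num.min 1 t0 by near: n; apply: near_quarter_scale; rewrite lt_min ltr01.
have sb : n%:R `^ (- ((1 - z) / 4 * beta)) < e / ((2 * A + 6) * C0 ^+ 3).
  by near: n; apply: near_powRN; [exact: mulr_gt0|exact: divr_gt0].
have [dl0 s0 L0] := scale_gt0 n0.
rewrite lt_min in s1; case/andP: s1 => s1 st.
have r0 : 0 < s n ^+ 3 < t0.
  rewrite exprn_gt0 //=; apply: le_lt_trans st.
  by rewrite exprS; apply: ler_piMr; [exact: ltW|apply: exprn_ile1; exact: ltW].
have sE : n%:R `^ (- ((1 - z) / 4 * beta)) = s n `^ beta.
  by rewrite /quarter_scale -powRrM mulNr.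
have := @oprob_le_const _ _ _ P _ (int_range (M + 2)) _ _
  (fun x _ => oprob_three_small_gaps indep mX x (fun y => cdf y r0)).
apply: oprob_leW.
  by move=> w [x xM h]; exists x => //; apply: mem_int_range; rewrite PoszD.
rewrite powR_exprn ?(ltW s0) //; set sg := s n `^ beta in sE *.
have rel := scale_relation n0.
rewrite gap_scale_quarter powR_exprn ?(ltW s0) // -/sg -gap_scale_quarter in rel.
have sg0 : 0 <= sg by exact: powR_ge0.
rewrite size_int_range.
have hsz : (2 * (M + 2).+1)%N%:R <= (2 * A + 6) * L n.
  by rewrite natrM -addnS natrD mulrDl; lra.
have p0 : 0 <= (C0 * sg ^+ 3) ^+ 3 by rewrite exprn_ge0 // mulr_ge0 ?exprn_ge0 // ltW.
apply: le_trans (ler_wpM2r p0 hsz) _.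
have -> : (2 * A + 6) * L n * (C0 * sg ^+ 3) ^+ 3 =
    (2 * A + 6) * C0 ^+ 3 * sg * (L n * (sg ^+ 4) ^+ 2) by ring.
by rewrite rel mulr1 mulrC -ler_pdivlMr // ltW // -sE.
Unshelve. all: by end_near. Qed.

(** The O(L^2) pairs cancel the factor [dl^(4 beta)] of the four gaps exactly; the bound [e] comes
    only from applying the concentration hypothesis with [e / Q], [Q] collecting the other
    constants. *)
Lemma near_near_ties (A D e : R) : 0 < A -> 0 < D -> 0 < e ->
  (forall K e, 0 < K -> 0 < e ->
    exists2 eta, 0 < eta <= 1 & exists2 dl0, 0 < dl0 & forall x dl a b,
      0 < dl < dl0 -> b <= K * dl -> b - a <= 4 * eta * dl ->
      (P (X (inl x) @^-1` gap_band c a b) <= (e * dl `^ beta)%:E)%E) ->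
  exists2 eta, 0 < eta & \forall n \near \oo, forall M : nat, M%:R <= A * L n ->
  oprob_le P [set w | bounded w /\ exists x y : int, [/\ `|x| <= M%:Z, `|y| <= M%:Z,
      2 <= `|x - y|, disc w x <= D * dl n &
      disc w x <= disc w y /\ disc w y < disc w x + eta * dl n]] e.
Proof.
move=> A0 D0 e0 conc; have b0 := beta_gt0; have C00 := C0_gt0.
have /andP[t00 t0c] := t0_lt.
pose Q := (2 * A + 2) ^+ 2 * (C0 * (D + 2) `^ beta) ^+ 3.
have Q0 : 0 < Q by rewrite mulr_gt0 ?exprn_gt0 ?mulr_gt0 ?powR_gt0 //; lra.
(* Covers the top of the bands: [(2 N + 3) h <= (2 (D + 2) + 3) dl], from [N eta <= D + 2] and
   [eta <= 1]. *)
have KK : 0 < 2 * D + 7 by lra.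
have [eta /andP[eta0 eta1] [dl1 dl10 hconc]] := conc _ _ KK (divr_gt0 e0 Q0).
exists eta => //.
near=> n => M ML.
have n0 : (0 < n)%N by near: n; exact: near_gt0.
have L1 : 1 <= L n by near: n; exact: near_range_scale.
have dlt : dl n < Num.min dl1 (t0 / (D + 2)).
  by near: n; apply: near_gap_scale; rewrite lt_min dl10 divr_gt0 //; lra.
have [dl0 _ L0] := scale_gt0 n0.
rewrite lt_min ltr_pdivlMr in dlt; last lra.
case/andP: dlt => dlt1 dlt2.
have De : 0 <= D / eta by rewrite divr_ge0 // ltW.
(* The number of cells does not depend on n. Two extra cells make them reach beyond [D + eta], a
   bound for both discrepancies in units of [dl]. *)
pose N := (Num.truncn (D / eta)).+2; have /andP[N1 N2] := truncn_itv De.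
have eN : N%:R = (Num.truncn (D / eta))%:R + 2 :> R by rewrite /N -addn2 natrD.
have N1' : N%:R * eta <= D + 2.
  move: N1; rewrite ler_pdivlMr // eN => h; lra.
have N2' : D + eta < N%:R * eta.
  move: N2; rewrite ltr_pdivrMr // eN (mulrSr 1 (Num.truncn _)); lra.
pose h := eta * dl n; have h0 : 0 < h by exact: mulr_gt0.
have Nh : N%:R * h <= (D + 2) * dl n by rewrite mulrA; apply: ler_wpM2r => //; exact: ltW.
have Nh' : (D + eta) * dl n < N%:R * h by rewrite mulrA ltr_pM2r.
have Nh0 : 0 < N%:R * h by rewrite mulr_gt0.
have Nht : N%:R * h < t0 by apply: le_lt_trans Nh _; rewrite mulrC.
pose p := C0 * ((D + 2) * dl n) `^ beta.
have hp x : (P (X (inl x) @^-1` small_gap c (N%:R * h)) <= p%:E)%E.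
  apply: le_trans (cdf x _) _; first by rewrite Nh0.
  rewrite lee_fin /p; apply: ler_wpM2l; first exact: ltW.
  apply: ge0_ler_powR; rewrite ?nnegrE ?(ltW b0) ?(ltW Nh0) //.
  by apply: le_trans Nh; exact: ltW.
have he x a b : b <= (2 * N%:R + 3) * h -> b - a <= 4 * h ->
    (P (X (inl x) @^-1` gap_band c a b) <= (e / Q * dl n `^ beta)%:E)%E.
  move=> hb hab; apply: hconc; first by rewrite dl0.
    apply: le_trans hb _; rewrite mulrDl -mulrA.
    have : h <= dl n by rewrite /h -[leRHS]mul1r; apply: ler_wpM2r => //; exact: ltW.
    by lra.
  by rewrite -mulrA.
have ee0 : 0 <= e / Q * dl n `^ beta by rewrite mulr_ge0 ?powR_ge0 // divr_ge0 // ltW.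
have Nc : N%:R * h <= c by lra.
have H x y : oprob_le P [set w | 2 <= `|x - y| /\ [/\ bounded w, disc w y < N%:R * h,
     disc w x <= disc w y & disc w y < disc w x + h]] (p ^+ 3 * (e / Q * dl n `^ beta)).
  case: (boolP (2 <= `|x - y|)) => xy.
    have := oprob_near_tie indep mX h0 Nc xy ee0 hp he.
    by apply: oprob_leW => // w [].
  apply: (oprob_leW (S' := set0) _ (lexx _)); first by move=> w [].
  by apply: oprob_le0; rewrite mulr_ge0 // exprn_ge0 // mulr_ge0 ?powR_ge0 // ltW.
have := @oprob_le_const _ _ _ P _ (int_range M) _ _ (fun x _ =>
  @oprob_le_const _ _ _ P _ (int_range M) _ _ (fun y _ => H x y)).
apply: oprob_leW.
  move=> w [bw [x [y [xM yM xy dx [dxy dyx]]]]].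
  exists x; first exact: mem_int_range.
  exists y; first exact: mem_int_range.
  split=> //; split => //; apply: lt_trans Nh'.
  by apply: lt_le_trans dyx _; rewrite mulrDl lerD2r.
rewrite size_int_range.
have hsz : (2 * M.+1)%N%:R <= (2 * A + 2) * L n.
  by rewrite natrM (mulrSr 1 M) mulrDl; lra.
set S := (2 * M.+1)%N%:R in hsz *; have S0 : 0 <= S by [].
have p0 : 0 <= p by rewrite mulr_ge0 ?powR_ge0 // ltW.
have pE : p = C0 * (D + 2) `^ beta * dl n `^ beta.
  by rewrite /p powRM ?mulrA // ?(ltW dl0) //; lra.
set q := p ^+ 3 * _; have q0 : 0 <= q by rewrite mulr_ge0 // exprn_ge0.
apply: (@le_trans _ _ (((2 * A + 2) * L n) ^+ 2 * q)).
  rewrite mulrA -expr2; apply: ler_wpM2r => //.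
  by rewrite lerXn2r ?nnegrE //; exact: le_trans hsz.
have rel := scale_relation n0.
have -> : ((2 * A + 2) * L n) ^+ 2 * q = Q * (e / Q) * (L n * (dl n `^ beta) ^+ 2) ^+ 2.
  by rewrite /q pE /Q; ring.
by rewrite rel expr1n mulr1 mulrC divfK // gt_eqF.
Unshelve. all: by end_near. Qed.

(** [w] is about [2 ln n / ln lam], so that one window fails with probability at most [2 / n^2] and
    all [n + 1] starting points together with at most [4 / n]. The windows are still cheap because
    [s ln n] tends to 0. *)
Lemma near_balanced (k : nat) (D e : R) : (0 < k)%N -> 0 < D -> 0 < e ->
  (forall i, P (X (inr i) @^-1` [set 1]) = (1 / 2)%:E /\
    P (X (inr i) @^-1` [set -1]) = (1 / 2)%:E) ->
  \forall n \near \oo, exists w : nat, [/\ (0 < w)%N,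
    (k * w).+1%:R * (D * dl n) < s n ^+ 3 &
    oprob_le P [set om | ~ forall u, (u <= n)%N -> balanced (fun i => X (inr i) om) k w u] e].
Proof.
move=> k0 D0 e0 sgnX.
pose lam : R := 1 + (4 * k%:R)^-1 / 2.
have lam1 : 1 < lam.
  by rewrite /lam ltrDl divr_gt0 // invr_gt0 mulr_gt0 // ltr0n.
have lnl : 0 < ln lam by exact: ln_gt0.
have z1 : 0 < (1 - z) / 4 by have := z01; lra.
pose A : R := D * (2 * k%:R / ln lam + k%:R + 1).
have A0 : 0 <= A by rewrite mulr_ge0 ?(ltW D0) // addr_ge0 // addr_ge0 // divr_ge0 ?mulr_ge0 // ltW.
near=> n.
have n0 : (0 < n)%N by near: n; exact: near_gt0.
have ne : 4 / e <= n%:R by near: n; exact: near_nat_ge.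
have hln : A * (ln n%:R + 1) * n%:R `^ (- ((1 - z) / 4)) < 1.
  by near: n; exact: near_log_powRN.
have [dl0 s0 L0] := scale_gt0 n0.
have n1 : 1 <= n%:R :> R by rewrite ler1n.
have ln0 : 0 <= ln n%:R :> R by exact: ln_ge0.
have q0 : 0 <= 2 * ln n%:R / ln lam by rewrite divr_ge0 ?mulr_ge0 // ltW.
have /andP[w1 w2] := truncn_itv q0.
exists (Num.truncn (2 * ln n%:R / ln lam)).+1.
set w := (Num.truncn _).+1 in w2 *; split => //.
  have wle : w%:R <= 2 * ln n%:R / ln lam + 1 by rewrite /w (mulrSr 1 (Num.truncn _)) lerD2r.
  have kw : (k * w).+1%:R <= (2 * k%:R / ln lam + k%:R + 1) * (ln n%:R + 1).
    rewrite (mulrSr 1 (k * w)) natrM.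
    have h1 := ler_wpM2l (ler0n R k) wle.
    have h2 : k%:R * (2 * ln n%:R / ln lam + 1) =
      2 * k%:R / ln lam * ln n%:R + k%:R by field; rewrite gt_eqF.
    have h3 : 0 <= k%:R * ln n%:R :> R by exact: mulr_ge0.
    have h4 : 0 <= 2 * k%:R / ln lam by rewrite divr_ge0 ?mulr_ge0 // ltW.
    by lra.
  rewrite gap_scale_quarter exprS mulrA mulrA -[ltRHS]mul1r ltr_pM2r ?exprn_gt0 //.
  apply: le_lt_trans hln; rewrite -/(s n); apply: ler_wpM2r; first exact: ltW.
  by rewrite /A mulrC -mulrA; apply: ler_wpM2l => //; exact: ltW.
have := @oprob_le_const _ _ _ P _ (iota 0 n.+1) _ _
  (fun u _ => oprob_unbalanced indep mX sgnX w u k0).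
apply: oprob_leW.
  move=> om h; apply: contrapT => h'; apply: h => u un; apply: contrapT => nb.
  by apply: h'; exists u; rewrite ?mem_iota.
rewrite size_iota -/lam.
have sq := exp_ge_square lam1 n0 (ltW w2).
have nn0 : 0 < n%:R ^+ 2 :> R by rewrite exprn_gt0 // ltr0n.
have linv : lam ^- w <= (n%:R ^+ 2)^-1.
  by rewrite lef_pV2 ?posrE //; exact: lt_le_trans sq.
have nS : n.+1%:R <= 2 * n%:R :> R by rewrite -natrM ler_nat mul2n -addnn -addn1 leq_add2l.
have lw0 : 0 <= lam ^- w by rewrite invr_ge0 exprn_ge0 // ltW // (lt_trans ltr01).
apply: (@le_trans _ _ (2 * n%:R * (2 * (n%:R ^+ 2)^-1))).
  apply: ler_pM => //; [by rewrite mulr_ge0|by apply: ler_wpM2l].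
have -> : 2 * n%:R * (2 * (n%:R ^+ 2)^-1) = 4 / n%:R :> R.
  by field; rewrite gt_eqF // ltr0n.
by rewrite ler_pdivrMr ?ltr0n // mulrC -ler_pdivrMr.
Unshelve. all: by end_near. Qed.

Lemma near_min_disc (A e : R) : 0 <= A -> 0 < e -> exists2 k1, 0 < k1 &
  \forall n \near \oo, forall M : nat, M%:R <= A * L n ->
  oprob_le P [set w | bounded w /\ exists2 x : int, `|x| <= M%:Z &
    disc w x <= k1 * dl n] e.
Proof.
move=> A0 e0; have b0 := beta_gt0; have C00 := C0_gt0; have /andP[t00 t0c] := t0_lt.
pose Q := (2 * A + 2) * C0 ^+ 2.
have Q0 : 0 < Q by rewrite mulr_gt0 ?exprn_gt0 //; lra.
have b20 : 0 < beta * 2 by rewrite mulr_gt0.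
(* With [k1^(2 beta) = e / Q] the union bound over O(L) edges is exactly [e]. *)
have [k1 k10 ek] := powR_root (divr_gt0 e0 Q0) b20.
rewrite powRrM powR_mulrn ?powR_ge0 // in ek.
exists k1 => //; near=> n => M ML.
have n0 : (0 < n)%N by near: n; exact: near_gt0.
have L1 : 1 <= L n by near: n; exact: near_range_scale.
have dlt : dl n < t0 / k1 by near: n; apply: near_gap_scale; exact: divr_gt0.
have [dl0 _ L0] := scale_gt0 n0.
rewrite ltr_pdivlMr // in dlt.
have tt : 0 < k1 * dl n < t0 by rewrite mulr_gt0 //= mulrC.
have := @oprob_le_const _ _ _ P _ (int_range M) _ _
  (fun x _ => oprob_small_disc indep mX x (fun y => cdf y tt)).
apply: oprob_leW.
  by move=> w [bw [x xM h]]; exists x => //; exact: mem_int_range.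
rewrite size_int_range powRM ?(ltW k10) ?(ltW dl0) //.
have hsz : (2 * M.+1)%N%:R <= (2 * A + 2) * L n.
  by rewrite natrM (mulrSr 1 M) mulrDl; lra.
have p0 : 0 <= (C0 * (k1 `^ beta * dl n `^ beta)) ^+ 2.
  by rewrite exprn_ge0 // !mulr_ge0 ?powR_ge0 // ltW.
apply: le_trans (ler_wpM2r p0 hsz) _.
have -> : (2 * A + 2) * L n * (C0 * (k1 `^ beta * dl n `^ beta)) ^+ 2 =
   Q * (k1 `^ beta) ^+ 2 * (L n * (dl n `^ beta) ^+ 2) by rewrite /Q; ring.
by rewrite scale_relation // ek mulr1 mulrC divfK // gt_eqF.
Unshelve. all: by end_near. Qed.

(** Here the threshold [D dl] is fixed, and smallness comes from the number of edges: only O(k1 L)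
    are examined. *)
Lemma near_no_close_small_disc (D e : R) : 0 < D -> 0 < e -> exists2 k1, 0 < k1 &
  \forall n \near \oo,
  oprob_le P [set w | bounded w /\ exists2 x : int, `|x%:~R| < k1 * L n &
    disc w x <= D * dl n] e.
Proof.
move=> D0 e0; have b0 := beta_gt0; have C00 := C0_gt0; have /andP[t00 t0c] := t0_lt.
pose Q := 4 * (C0 * D `^ beta) ^+ 2.
have Q0 : 0 < Q by rewrite mulr_gt0 ?exprn_gt0 ?mulr_gt0 ?powR_gt0.
have k10 : 0 < e / Q by exact: divr_gt0.
exists (e / Q) => //; near=> n.
have n0 : (0 < n)%N by near: n; exact: near_gt0.
have L1 : (e / Q)^-1 <= L n by near: n; exact: near_range_scale.
have dlt : dl n < t0 / D by near: n; apply: near_gap_scale; exact: divr_gt0.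
have [dl0 _ L0] := scale_gt0 n0.
rewrite ltr_pdivlMr // in dlt; rewrite -div1r ler_pdivrMr // mulrC in L1.
have tt : 0 < D * dl n < t0 by rewrite mulr_gt0 //= mulrC.
have kL : 0 <= e / Q * L n by lra.
pose M := Num.truncn (e / Q * L n); have /andP[M1 M2] := truncn_itv kL.
have := @oprob_le_const _ _ _ P _ (int_range M) _ _
  (fun x _ => oprob_small_disc indep mX x (fun y => cdf y tt)).
apply: oprob_leW.
  move=> w [bw [x xk h]]; exists x => //; apply: mem_int_range.
  have : (`|x|%N)%:R < M.+1%:R :> R.
    by apply: lt_trans M2; rewrite natr_absz intr_norm.
  by rewrite ltr_nat ltnS => xM; rewrite -abszE lez_nat.
rewrite size_int_range powRM ?(ltW D0) ?(ltW dl0) //.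
have hsz : (2 * M.+1)%N%:R <= 4 * (e / Q * L n).
  by rewrite natrM (mulrSr 1 M); move: M1 L1; rewrite -/M; lra.
have p0 : 0 <= (C0 * (D `^ beta * dl n `^ beta)) ^+ 2.
  by rewrite exprn_ge0 // !mulr_ge0 ?powR_ge0 // ltW.
apply: le_trans (ler_wpM2r p0 hsz) _.
have -> : 4 * (e / Q * L n) * (C0 * (D `^ beta * dl n `^ beta)) ^+ 2 =
   e / Q * Q * (L n * (dl n `^ beta) ^+ 2) by rewrite [in RHS]/Q; ring.
by rewrite scale_relation // mulr1 divfK // gt_eqF.
Unshelve. all: by end_near. Qed.

End ScaledEvents.

(** The cost [W D dl] of a window is below [r], and [1 <= n dl] turns this into a bound on [W D]
    itself. *)
Lemma window_length_bound (R : realFieldType) (D dl n W r y : R) :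
  0 <= D -> 0 <= W -> 0 <= n -> 0 <= dl -> 1 <= n * dl -> (W + 1) * (D * dl) < r -> r <= y ->
  D * W <= n * y.
Proof.
move=> D0 W0 n0 dl0 ndl hr ry.
have h1 : D * W * 1 <= D * W * (n * dl) by apply: ler_wpM2l => //; exact: mulr_ge0.
have h2 : 0 <= D * dl by exact: mulr_ge0.
have h3 : n * (W * (D * dl)) <= n * y by apply: ler_wpM2l => //; lra.
lra.
Qed.

Lemma min3_exists (R : realFieldType) (a b e : R) : 0 < a -> 0 < b -> 0 < e ->
  exists2 k, 0 < k & [/\ k <= a, k <= b & k <= e].
Proof.
move=> a0 b0 e0; exists (Num.min a (Num.min b e)); first by rewrite !lt_min a0 b0.
by split; rewrite !ge_min lexx ?orbT.
Qed.

(** * Union of the exceptional events *)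

Section GoodWalks.
Context {R : realType} {d : measure_display} {T : measurableType d}.
Variables (P : probability T R) (X : int + int -> T -> R) (c beta z : R).
Hypothesis indep : mutually_independent P X.
Hypothesis mX : forall i, measurable_fun setT (X i).
Hypothesis sgnX : forall i, P (X (inr i) @^-1` [set 1]) = (1 / 2)%:E /\
  P (X (inr i) @^-1` [set -1]) = (1 / 2)%:E.
Hypothesis identX : forall x y (A : set R), measurable A ->
  P (X (inl x) @^-1` A) = P (X (inl y) @^-1` A).
Hypothesis outX : forall x, P (X (inl x) @^-1` [set y | c <= `|y|]) = 0%E.
Hypothesis c_gt0 : 0 < c.
Hypothesis beta_gt0 : 0 < beta.
Hypothesis z01 : 0 < z < 1.
Hypothesis z_beta : z + (z - 1) * (2 * beta) = 0.
Variables (C0 t0 C1 t1 : R).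
Hypothesis C0_gt0 : 0 < C0.
Hypothesis t0_lt : 0 < t0 < c.
Hypothesis cdf : forall x t, 0 < t < t0 ->
  (P (X (inl x) @^-1` small_gap c t) <= (C0 * t `^ beta)%:E)%E.
Hypothesis C1_gt0 : 0 < C1.
Hypothesis t1_gt0 : 0 < t1.
Hypothesis lower : forall x t, 0 < t < t1 ->
  ((C1 * t `^ beta)%:E <= P (X (inl x) @^-1` `[(c - t)%R, (c - t / 2)%R]%classic))%E /\
  ((C1 * t `^ beta)%:E <= P (X (inl x) @^-1` `[(t / 2 - c)%R, (t - c)%R]%classic))%E.
Hypothesis conc : forall K e, 0 < K -> 0 < e ->
  exists2 eta, 0 < eta <= 1 & exists2 dl0, 0 < dl0 & forall x dl a b,
    0 < dl < dl0 -> b <= K * dl -> b - a <= 4 * eta * dl ->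
    (P (X (inl x) @^-1` gap_band c a b) <= (e * dl `^ beta)%:E)%E.
Local Notation f := (fun w x => X (inl x) w).
Local Notation b := (fun w i => X (inr i) w).

(** Quantifying over all minimizers and argmins inside the event makes it depend on the environment
    only, whatever selection is made afterwards. *)
Definition good_walks (k1 k2 : R) (n : nat) (w : T) : Prop :=
  forall g l, minimizing_walk (b w) (f w) n g -> is_argmin_discrepancy c (f w) n g l ->
  [/\ stays_after_hit n g l,
      k1 * n%:R `^ z <= `|l%:~R : R| <= k2 * n%:R `^ z,
      k1 * n%:R `^ (z - 1) <= discrepancy c (f w) l <= k2 * n%:R `^ (z - 1) &
      k1 * n%:R `^ z <= c * n%:R + action (b w) (f w) n g <= k2 * n%:R `^ z].

(** The order of the constants matters: [K1] fixes the cost bound [K], which fixes the range [A],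
    then the separation [eta], then the precision [k]. Seven events of probability at most [eps / 7]
    and two null events are excluded. *)
Lemma oprob_not_good_walks (eps : R) : 0 < eps -> exists k1 k2, 0 < k1 /\ k1 < k2 /\
  exists N : nat, forall n, (N <= n)%N -> oprob_le P [set w | ~ good_walks k1 k2 n w] eps.
Proof.
move=> eps0; have c0 := c_gt0.
have eps7 : 0 < eps / 7 by lra.
have [e e0 [e1 e_eps _]] := min3_exists (@ltr01 R) eps7 eps7.
have e01 : 0 < e <= 1 by rewrite e0.
have [K1 K10 near1] := near_small_disc_exists indep mX beta_gt0 z01 z_beta C1_gt0 t1_gt0
  lower identX e01.
have [K eK] : exists K, K = 2 * c + K1 by exists (2 * c + K1).
have K0 : 0 < K by rewrite eK; lra.
have [A A0 near2] := near_gaps_sum mX beta_gt0 z01 C0_gt0 t0_lt cdf K0 e0.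
have near3 := near_three_small_gaps indep mX beta_gt0 z01 z_beta C0_gt0 t0_lt cdf (ltW A0) e0.
have D0 : 0 < 9 * K by lra.
have [eta eta0 near4] := near_near_ties indep mX beta_gt0 z01 z_beta C0_gt0 t0_lt cdf A0 D0 e0 conc.
have [k k2 hk] : exists2 k, (2 <= k)%N & 2 * (9 * K) <= eta * (k%:R - 1).
  have q0 : 0 <= 2 * (9 * K) / eta by rewrite divr_ge0 // ?mulr_ge0 // ltW.
  have /andP[_] := truncn_itv q0; set j := Num.truncn _ => h; exists j.+2 => //.
  by rewrite (mulrSr 1 j.+1) addrK [leRHS]mulrC -ler_pdivrMr // ltW.
have near5 := near_balanced indep mX z01 (ltnW k2) D0 e0 sgnX.
have [ka ka0 near6] := near_min_disc indep mX beta_gt0 z01 z_beta C0_gt0 t0_lt cdf (ltW A0) e0.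
have [kb kb0 near7] := near_no_close_small_disc indep mX beta_gt0 z01 z_beta C0_gt0 t0_lt cdf D0 e0.
have [k1 k10 [k1a k1b k1K]] := min3_exists ka0 kb0 D0.
have k18 : 0 < k1 / 8 by lra.
have k18' : k1 / 8 <= k1 by lra.
have AK : A <= A + 8 * K by lra.
have KA : K <= A + 8 * K by lra.
have K8A : 8 * K <= A + 8 * K by lra.
(* A single bound [y] on [r]: it gives [r <= c] and, through [window_length_bound], both conditions
   on the incomplete window. *)
have [y y0 [yk yK yc]] := min3_exists k18 K0 c0.
exists (k1 / 8), (A + 8 * K); split => //; split; first lra.
suff [N _ hN] : \forall n \near \oo,
    oprob_le P [set w | ~ good_walks (k1 / 8) (A + 8 * K) n w] eps by exists N.
near=> n.
have n0 : (0 < n)%N by near: n; exact: near_gt0.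
have L1 : 1 <= n%:R * gap_scale z n by near: n; exact: near_range_scale.
have sy : quarter_scale z n < Num.min 1 y.
  by near: n; apply: near_quarter_scale => //; rewrite lt_min ltr01.
have dl1 : gap_scale z n < 1 by near: n; exact: near_gap_scale.
have E1 : oprob_le P [set w | ~ exists2 j : nat, (2 * j)%N%:R <= n%:R * gap_scale z n &
      discrepancy c (f w) (2 * j)%N%:Z <= K1 * gap_scale z n] e by near: n; exact: near1.
have [M [M0 ML E2]] : exists M : nat, [/\ (0 < M)%N, M%:R <= A * (n%:R * gap_scale z n) &
    oprob_le P [set w | (forall x, `|X (inl x) w| <= c) /\
      ~ (K * (n%:R * gap_scale z n) < \sum_(1 <= v < M.+1) gap c (f w) v%:Z /\
         K * (n%:R * gap_scale z n) < \sum_(1 <= v < M.+1) gap c (f w) (- v%:Z))] e].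
  by near: n; exact: near2.
have [m [m0 hm E5]] : exists w : nat, [/\ (0 < w)%N,
    (k * w).+1%:R * (9 * K * gap_scale z n) < quarter_scale z n ^+ 3 &
    oprob_le P [set om | ~ forall u, (u <= n)%N -> balanced (b om) k w u] e].
  by near: n; exact: near5.
have E3 : forall M : nat, M%:R <= A * (n%:R * gap_scale z n) ->
  oprob_le P [set w | exists2 x : int, `|x| <= M%:Z + 2 &
    [/\ gap c (f w) x < quarter_scale z n ^+ 3, gap c (f w) (x + 1) < quarter_scale z n ^+ 3 &
        gap c (f w) (x + 2) < quarter_scale z n ^+ 3]] e.
  by near: n; exact: near3.
have {}E3 := E3 M ML.
have E4 : forall M : nat, M%:R <= A * (n%:R * gap_scale z n) ->
  oprob_le P [set w | (forall x, `|X (inl x) w| <= c) /\ exists x y : int,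
    [/\ `|x| <= M%:Z, `|y| <= M%:Z, 2 <= `|x - y|,
      discrepancy c (f w) x <= 9 * K * gap_scale z n &
      discrepancy c (f w) x <= discrepancy c (f w) y /\
      discrepancy c (f w) y < discrepancy c (f w) x + eta * gap_scale z n]] e.
  by near: n; exact: near4.
have {}E4 := E4 M ML.
have E6 : forall M : nat, M%:R <= A * (n%:R * gap_scale z n) ->
  oprob_le P [set w | (forall x, `|X (inl x) w| <= c) /\ exists2 x : int, `|x| <= M%:Z &
    discrepancy c (f w) x <= ka * gap_scale z n] e.
  by near: n; exact: near6.
have {}E6 := E6 M ML.
have E7 : oprob_le P [set w | (forall x, `|X (inl x) w| <= c) /\
    exists2 x : int, `|x%:~R| < kb * (n%:R * gap_scale z n) &
    discrepancy c (f w) x <= 9 * K * gap_scale z n] e.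
  by near: n; exact: near7.
have E0 := oprob_unbounded mX outX.
have Es := oprob_not_sign mX sgnX.
have [dl0 s0 L0] := scale_gt0 z n0.
rewrite lt_min in sy; case/andP: sy => s1 sy.
have r_y : quarter_scale z n ^+ 3 <= y.
  apply: le_trans (ltW sy); rewrite exprS; apply: ler_piMr; first exact: ltW.
  by apply: exprn_ile1; exact: ltW.
have := oprob_leU E0 (oprob_leU Es (oprob_leU E1 (oprob_leU E2 (oprob_leU E3
  (oprob_leU E4 (oprob_leU E5 (oprob_leU E6 E7))))))).
apply: oprob_leW; last by rewrite ler_pdivlMr // in e_eps; lra.
move=> w ngood; apply: contrapT.
move=> /not_orP[n0' /not_orP[ns /not_orP[nn1 /not_orP[nn2 /not_orP[nn3
  /not_orP[nn4 /not_orP[nn5 /not_orP[nn6 nn7]]]]]]]].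
apply: ngood => g l gm lam.
have bw x : `|X (inl x) w| <= c by apply: contrapT => h; apply: n0'; exists x.
have sg i : X (inr i) w = 1 \/ X (inr i) w = -1.
  by apply: contrapT => h; apply: ns; exists i.
have [S1 S2] := contrapT (fun h => nn2 (conj bw h)).
have dl01 : 0 < gap_scale z n <= 1 by rewrite dl0 ltW.
have hk1 : 0 < k1 <= 9 * (2 * c + K1) by rewrite k10 -eK.
have hm' : ((k * m)%:R + 1) * (9 * K * gap_scale z n) < quarter_scale z n ^+ 3.
  by rewrite natr1.
have WL y' : y <= y' -> 9 * K * (k * m)%:R <= n%:R * y'.
  move=> yy; apply: (window_length_bound _ _ _ _ L1 hm') => //; try exact: ltW.
  exact: le_trans yy.
have [] := @environment_conclusion R c (b w) (f w) n k m M g l (gap_scale z n) K1 k1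
  (quarter_scale z n ^+ 3) (eta * gap_scale z n) c0 bw sg gm lam dl01 (ltW K10) hk1
  (le_trans r_y yc) k2 m0 (contrapT nn1).
- by rewrite -eK.
- by rewrite -eK.
- by move=> x xM h; apply: nn3; exists x.
- exact: contrapT nn5.
- move=> x xM; rewrite ltNge; apply/negP => h; apply: nn6; split => //; exists x => //.
  by apply: le_trans h _; apply: ler_wpM2r => //; exact: ltW.
- rewrite -eK => x xk; rewrite ltNge; apply/negP => h; apply: nn7; split => //; exists x => //.
  by apply: lt_le_trans xk _; apply: ler_wpM2r => //; exact: ltW.
- by rewrite mulr_ge0 // ltW.
- by rewrite -eK mulrA [leRHS]mulrAC; apply: ler_wpM2r => //; exact: ltW.
- rewrite -eK => x y' xM yM xy dx dxy; rewrite leNgt; apply/negP => h.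
  by apply: nn4; split => //; exists x, y'.
- by rewrite -eK.
- by rewrite -eK; exact: WL.
- by rewrite -eK; exact: WL.
rewrite -eK => st [l1 l2] /andP[d1 d2] /andP[a1 a2].
rewrite range_scaleE // -/(gap_scale z n) in l1 a1 a2 *.
have Z0 : 0 < n%:R `^ z :> R by rewrite powR_gt0 // ltr0n.
have lM : `|l%:~R : R| <= A * n%:R `^ z.
  rewrite -(range_scaleE z n0); apply: le_trans ML; rewrite -intr_norm -[M%:R]/(M%:Z%:~R).
  by rewrite ler_int ltW.
split => //; apply/andP; split.
- by apply: le_trans l1; rewrite ler_pM2r.
- by apply: le_trans lM _; rewrite ler_pM2r.
- by apply: le_trans d1; rewrite ler_pM2r.
- by apply: le_trans d2 _; rewrite ler_pM2r.
- by [].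
- by apply: le_trans a2 _; rewrite ler_pM2r.
Unshelve. all: by end_near. Qed.

End GoodWalks.

Theorem theorem2p4 (R : realType) (c q kappa : R)
  (rho : R -> R) (d : measure_display) (T : measurableType d)
  (P : probability T R) (F B : int -> T -> R)
  (gbar : nat -> T -> nat -> int) (ell : nat -> T -> int) :
  0 < c -> 0 < q -> -1 < kappa ->
  (* the density rho *)
  (forall x, rho (- x) = rho x) ->
  {in `]- c, c[, continuous rho} ->
  (forall x, - c < x < c -> 0 < rho x) ->
  (forall x, ~ (- c < x < c) -> rho x = 0) ->
  (fun x => rho x / (c - x) `^ kappa) @ c^'- --> q ->
  (* the random variables *)
  (forall x, measurable_fun setT (F x)) ->
  (forall i, measurable_fun setT (B i)) ->
  (forall x (A : set R), measurable A ->
     P (F x @^-1` A) = (\int[lebesgue_measure]_(y in A) (rho y)%:E)%E) ->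
  (forall i, P (B i @^-1` [set 1]) = (1 / 2)%:E /\
             P (B i @^-1` [set -1]) = (1 / 2)%:E) ->
  mutually_independent P
    (fun k : int + int => match k with inl x => F x | inr i => B i end) ->
  (* the (arbitrarily selected) minimizers and argmins *)
  (forall n w, minimizing_walk (fun i => B i w) (fun x => F x w) n (gbar n w)) ->
  (forall n w, is_argmin_discrepancy c (fun x => F x w) n (gbar n w) (ell n w)) ->
  let zeta := (2 * kappa + 2) / (2 * kappa + 3) in
  (forall eps : R, 0 < eps -> exists N : nat, forall n : nat, (N <= n)%N ->
     prob_ge P [set w | stays_after_hit n (gbar n w) (ell n w)] (1 - eps))
  /\
  (forall eps : R, 0 < eps -> exists k1 k2 : R, 0 < k1 /\ k1 < k2 /\
     exists N : nat, forall n : nat, (N <= n)%N ->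
     [/\ prob_ge P [set w | k1 * n%:R `^ zeta <= `|(ell n w)%:~R : R|
                            <= k2 * n%:R `^ zeta] (1 - eps),
         prob_ge P [set w | k1 * n%:R `^ (zeta - 1)
                            <= discrepancy c (fun x => F x w) (ell n w)
                            <= k2 * n%:R `^ (zeta - 1)] (1 - eps) &
         prob_ge P [set w | k1 * n%:R `^ zeta
                            <= c * n%:R + action (fun i => B i w) (fun x => F x w) n (gbar n w)
                            <= k2 * n%:R `^ zeta] (1 - eps)]).
Proof.
move=> c0 q0 kap even cont pos out edge mF mB dens sgn indep gm gl zeta.
pose X (k : int + int) := match k with inl x => F x | inr i => B i end.
have mX k : measurable_fun setT (X k) by case: k.
have b0 : 0 < kappa + 1 by lra.
have kne : 2 * kappa + 3 != 0 by apply: lt0r_neq0; lra.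
have z01 : 0 < zeta < 1.
  rewrite /zeta; apply/andP; split; first by rewrite divr_gt0 //; lra.
  by rewrite ltr_pdivrMr; lra.
have zb : zeta + (zeta - 1) * (2 * (kappa + 1)) = 0 by rewrite /zeta; field.
have [C0 C00 [t0 t0c cdf]] := prob_small_gap c0 q0 kap even cont pos out edge mF dens.
have [C1 C10 [t1 t10 low]] := prob_edge_lower c0 q0 kap even cont edge dens.
have conc := prob_gap_concentration c0 q0 kap even cont pos out edge mF dens.
have ident x y (A : set R) : measurable A -> P (X (inl x) @^-1` A) = P (X (inl y) @^-1` A).
  by move=> mA; rewrite /X !dens.
have outX := prob_outside out dens.
have main := @oprob_not_good_walks R d T P X c (kappa + 1) zeta indep mX sgn ident outX
  c0 b0 z01 zb C0 t0 C1 t1 C00 t0c cdf C10 t10 low conc.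
have good k1 k2 n w : good_walks X c zeta k1 k2 n w ->
    [/\ stays_after_hit n (gbar n w) (ell n w),
      k1 * n%:R `^ zeta <= `|(ell n w)%:~R : R| <= k2 * n%:R `^ zeta,
      k1 * n%:R `^ (zeta - 1) <= discrepancy c (fun x => F x w) (ell n w)
        <= k2 * n%:R `^ (zeta - 1) &
      k1 * n%:R `^ zeta <=
        c * n%:R + action (fun i => B i w) (fun x => F x w) n (gbar n w)
        <= k2 * n%:R `^ zeta] by apply; [exact: gm|exact: gl].
split=> eps eps0; have [k1 [k2 [k10 [k12 [N hN]]]]] := main eps eps0.
  exists N => n Nn; apply: prob_ge_compl; apply: (oprob_leW _ (lexx _) (hN n Nn)).
  by move=> w h /good[].
exists k1, k2; split => //; split => //; exists N => n Nn.
by split; apply: prob_ge_compl; apply: (oprob_leW _ (lexx _) (hN n Nn)) => w h /good[].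
Qed.
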